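(* Let $(R,\Lambda)$ be a Noetherian algebra. If $R$ is semi-local and $\dim R=1$, then $(R,\Lambda)$ is compatible. Thus the map $\Phi_{\rm t}:\mathcal T\mapsto(\mathcal T_{\mathfrak p}\cap\mathsf{fl}\,\Lambda_{\mathfrak p})_{\mathfrak p\in\operatorname{Spec}R}$ gives an isomorphism of posets $\Phi_{\rm t}:\mathsf{tors}\,\Lambda\simeq\mathbb T_R^{\rm c}(\Lambda)$.
   Context: A Noetherian algebra $(R,\Lambda)$ is a commutative Noetherian ring $R$ with a (not necessarily commutative) $R$-algebra $\Lambda$ that is finitely generated as an $R$-module. $\Lambda_{\mathfrak p}:=R_{\mathfrak p}\otimes_R\Lambda$. $\mathsf{mod}$ and $\mathsf{fl}$ denote finitely generated, respectively finite length, left modules. A torsion class of an abelian category is a full subcategory (containing $0$, closed under isomorphisms) closed under extensions and factor objects; $\mathsf{tors}\,\mathcal A$ is the set of torsion classes of $\mathcal A$ ordered by inclusion, $\mathsf{tors}\,\Lambda:=\mathsf{tors}(\mathsf{mod}\,\Lambda)$. For a subcategory $\mathcal C$ of modules, $\mathcal C_{\mathfrak p}:=\{X_{\mathfrak p}\mid X\in\mathcal C\}$. Put $\mathbb T_R(\Lambda):=\prod_{\mathfrak p\in\operatorname{Spec}R}\mathsf{tors}(\mathsf{fl}\,\Lambda_{\mathfrak p})$ with componentwise order. For $\mathcal X\in\mathsf{tors}(\mathsf{fl}\,\Lambda_{\mathfrak p})$ let $\psi_{\mathfrak p}(\mathcal X):=\{X\in\mathsf{mod}\,\Lambda_{\mathfrak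 p}\mid X/\mathfrak pX\in\mathcal X\}$, and for primes $\mathfrak p\supseteq\mathfrak q$ define ${\rm r}_{\mathfrak p,\mathfrak q}(\mathcal X):=\psi_{\mathfrak p}(\mathcal X)_{\mathfrak q}\cap\mathsf{fl}\,\Lambda_{\mathfrak q}\in\mathsf{tors}(\mathsf{fl}\,\Lambda_{\mathfrak q})$. An element $(\mathcal X^{\mathfrak p})_{\mathfrak p}\in\mathbb T_R(\Lambda)$ is compatible if ${\rm r}_{\mathfrak p,\mathfrak q}(\mathcal X^{\mathfrak p})\supseteq\mathcal X^{\mathfrak q}$ for all pairs of primes $\mathfrak p\supseteq\mathfrak q$; $\mathbb T^{\rm c}_R(\Lambda)$ is the subposet of compatible elements. The pair $(R,\Lambda)$ is called compatible if the image of $\Phi_{\rm t}:\mathsf{tors}\,\Lambda\to\mathbb T_R(\Lambda)$ equals $\mathbb T_R^{\rm c}(\Lambda)$. *)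

(* Defs.v *)
From HB Require Import structures.
From mathcomp Require Import all_boot all_algebra generic_quotient ring_quotient.
From mathcomp Require Import boolp ring.

Set Implicit Arguments.
Unset Strict Implicit.
Unset Printing Implicit Defensive.

Import GRing.Theory.
Local Open Scope ring_scope.
Local Open Scope quotient_scope.

(* In this file submodules and ideals are boolean predicates, as in MathComp.
   By excluded middle (asbool) this covers all submodules and all ideals.
   Rings of type pzRingType may be zero: a localization of an algebra at a
   prime outside of its support is the zero ring. *)

Definition restrict (A B : pzRingType) (f : {rmorphism A -> B})
  (M : lmodType B) : Type := M.

Section Restriction.
Variables (A B : pzRingType) (f : {rmorphism A -> B}) (M : lmodType B).

HB.instance Definition _ := GRing.Zmodule.on (restrict f M).

Let scale (a : A) (x : restrict f M) : restrict f M := f a *: (x : M).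

Let scaleA a b x : scale a (scale b x) = scale (a * b) x.
Proof. by rewrite /scale rmorphM scalerA. Qed.
Let scale1 : left_id 1 scale.
Proof. by move=> x; rewrite /scale rmorph1 scale1r. Qed.
Let scaleDr : right_distributive scale +%R.
Proof. by move=> a x y; rewrite /scale scalerDr. Qed.
Let scaleDl x : {morph scale^~ x : a b / a + b}.
Proof. by move=> a b; rewrite /scale rmorphD scalerDl. Qed.

HB.instance Definition _ := GRing.Zmodule_isLmodule.Build A (restrict f M)
  scaleA scale1 scaleDr scaleDl.

End Restriction.

Section QuotientModule.
Variables (A : pzRingType) (M : lmodType A) (N : submodClosed M).

Definition submod_pred : M -> bool := fun x => x \in N.

Let submod_pred_zmod : zmod_closed submod_pred.
Proof.
split=> [|x y Nx Ny]; first exact: (rpred0 N).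
by rewrite -scaleN1r; apply: (@rpredD _ N); rewrite // rpredZ.
Qed.
HB.instance Definition _ := GRing.isZmodClosed.Build M submod_pred
  submod_pred_zmod.
Definition submod_zmod : zmodClosed M := GRing.ZmodClosed.clone M submod_pred _.

Definition quotmod : Type := Quotient.quot submod_zmod.
HB.instance Definition _ := GRing.Zmodule.on quotmod.
HB.instance Definition _ := EqQuotient.on quotmod.

Definition quotmod_pi (x : M) : quotmod := \pi_(Quotient.quot submod_zmod) x.

Let scale (a : A) (u : quotmod) : quotmod :=
  quotmod_pi (a *: repr (u : Quotient.quot submod_zmod)).

Lemma quotmod_piE x y : quotmod_pi x = quotmod_pi y <-> x - y \in N.
Proof.
rewrite /quotmod_pi; split=> [/eqP|Nxy]; first by rewrite -Quotient.idealrBE.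
by apply/eqP; rewrite -Quotient.idealrBE.
Qed.

Lemma quotmod_piD x y : quotmod_pi (x + y) = quotmod_pi x + quotmod_pi y.
Proof. exact: (Quotient.pi_add submod_zmod). Qed.

Lemma quotmod_ind (P : quotmod -> Prop) : (forall x, P (quotmod_pi x)) -> forall u, P u.
Proof. by move=> Ppi; elim/quotW=> x; apply: Ppi. Qed.

Let scale_pi a x : scale a (quotmod_pi x) = quotmod_pi (a *: x).
Proof.
apply/quotmod_piE; rewrite -scalerBr rpredZ //; apply/quotmod_piE.
by rewrite /quotmod_pi reprK.
Qed.

Let scaleA a b u : scale a (scale b u) = scale (a * b) u.
Proof. by elim/quotmod_ind: u => x; rewrite !scale_pi scalerA. Qed.
Let scale1 : left_id 1 scale.
Proof. by elim/quotmod_ind => x; rewrite scale_pi scale1r. Qed.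
Let scaleDr : right_distributive scale +%R.
Proof.
move=> a; elim/quotmod_ind => x; elim/quotmod_ind => y.
by rewrite -quotmod_piD !scale_pi scalerDr quotmod_piD.
Qed.
Let scaleDl u : {morph scale^~ u : a b / a + b}.
Proof.
by elim/quotmod_ind: u => x a b; rewrite !scale_pi scalerDl quotmod_piD.
Qed.

HB.instance Definition _ := GRing.Zmodule_isLmodule.Build A quotmod
  scaleA scale1 scaleDr scaleDl.

Lemma quotmod_pi_is_linear : linear quotmod_pi.
Proof. by move=> a x y; rewrite quotmod_piD -scale_pi. Qed.
HB.instance Definition _ := GRing.isLinear.Build A M quotmod _ quotmod_pi
  quotmod_pi_is_linear.

End QuotientModule.

(* This is used instead of algType, whose instances are nonzero. *)
Record algebra (R : pzRingType) := Algebra {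
  alg_ring :> pzRingType;
  alg_map : {rmorphism R -> alg_ring};
  alg_mapC : forall (r : R) (x : alg_ring), alg_map r * x = x * alg_map r
}.
Arguments alg_map {R} L : rename.
Arguments alg_mapC {R} L r x : rename.

Section Denominators.
Variables (R : comNzRingType) (p : prime_idealr R).

Record denom := Denom { den : R; denP : den \notin p }.
HB.instance Definition _ := [isSub for den].
HB.instance Definition _ := [Choice of denom by <:].

Lemma den1_subproof : 1 \notin p. Proof. by rewrite idealr1. Qed.
Definition den1 := Denom den1_subproof.

Lemma denM_subproof (s t : denom) : den s * den t \notin p.
Proof. by rewrite prime_idealrM negb_or !denP. Qed.
Definition denM s t := Denom (denM_subproof s t).

Lemma denMA s t u : denM s (denM t u) = denM (denM s t) u.
Proof. by apply: val_inj; rewrite /= mulrA. Qed.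
Lemma denMC s t : denM s t = denM t s.
Proof. by apply: val_inj; rewrite /= mulrC. Qed.
Lemma den1M s : denM den1 s = s.
Proof. by apply: val_inj; rewrite /= mul1r. Qed.

End Denominators.
Arguments den1 {R p}.

(* The localization R_p \otimes_R M of a module M over an R-algebra L at a prime
   p of R, as a module of fractions; see loc_tens_universal below. *)
Section Localization.
Variables (R : comNzRingType) (L : algebra R) (p : prime_idealr R).

Local Notation "r ** x" := (alg_map L r *: x) (at level 40).

Lemma alg_scaleC (M : lmodType L) r (a : L) (x : M) : r ** (a *: x) = a *: (r ** x).
Proof. by rewrite !scalerA alg_mapC. Qed.

Lemma alg_scaleM (M : lmodType L) r s (x : M) : r ** (s ** x) = (r * s) ** x.
Proof. by rewrite scalerA rmorphM. Qed.

Section Module.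
Variable M : lmodType L.

Definition loc_eq (x y : M * denom p) : bool :=
  `[< exists u : denom p, den u ** (den y.2 ** x.1) = den u ** (den x.2 ** y.1) >].

Lemma loc_eq_equiv : equiv_class_of loc_eq.
Proof.
split=> [x|x y|y x z].
- by apply/asboolP; exists den1.
- by apply/asboolP/asboolP=> -[u e]; exists u.
- move=> /asboolP[u e] /asboolP[v f]; apply/asboolP.
  exists (denM y.2 (denM u v)).
  have {}e := congr1 (fun t => (den v * den z.2) ** t) e.
  have {}f := congr1 (fun t => (den u * den x.2) ** t) f.
  rewrite !alg_scaleM in e f *.
  transitivity ((den v * den z.2 * den u * den y.2) ** x.1).
    by congr (alg_map L _ *: _) => /=; ring.
  rewrite e; transitivity ((den u * den x.2 * den v * den z.2) ** y.1).
    by congr (alg_map L _ *: _) => /=; ring.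
  by rewrite f; congr (alg_map L _ *: _) => /=; ring.
Qed.
Canonical loc_eq_equiv_rel := EquivRelPack loc_eq_equiv.
Canonical loc_eq_encModRel := defaultEncModRel loc_eq.

Definition loc : Type := {eq_quot loc_eq}.
HB.instance Definition _ : EqQuotient _ loc_eq loc := EqQuotient.on loc.
HB.instance Definition _ := Choice.on loc.

Definition frac (x : M) (s : denom p) : loc := \pi_loc (x, s).

Lemma frac_eqP x s y t :
  frac x s = frac y t <-> exists u : denom p, den u ** (den t ** x) = den u ** (den s ** y).
Proof.
split=> [/eqmodP/asboolP//|e]; exact/eqmodP/asboolP.
Qed.

Lemma frac_ind (P : loc -> Prop) : (forall x s, P (frac x s)) -> forall u, P u.
Proof. by move=> Pf; elim/quotW=> -[x s]; apply: Pf. Qed.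

Lemma frac_repr (u : loc) : frac (repr u).1 (repr u).2 = u.
Proof. by rewrite /frac -surjective_pairing reprK. Qed.

Lemma frac_cancel u x s : frac (den u ** x) (denM u s) = frac x s.
Proof.
apply/frac_eqP; exists den1; congr (_ *: _).
by rewrite alg_scaleM /= mulrC.
Qed.

Let add (u v : loc) : loc :=
  frac (den (repr v).2 ** (repr u).1 + den (repr u).2 ** (repr v).1)
       (denM (repr u).2 (repr v).2).
Let opp (u : loc) : loc := frac (- (repr u).1) (repr u).2.

Let addE x s y t :
  add (frac x s) (frac y t) = frac (den t ** x + den s ** y) (denM s t).
Proof.
rewrite /add; case: (repr _) (frac_repr (frac x s)) => x' s' /= /frac_eqP[u e].
case: (repr _) (frac_repr (frac y t)) => y' t' /= /frac_eqP[v f].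
apply/frac_eqP; exists (denM u v).
have {}e := congr1 (fun z => (den v * den t * den t') ** z) e.
have {}f := congr1 (fun z => (den u * den s * den s') ** z) f.
rewrite !scalerDr !alg_scaleM /= in e f *.
congr (_ + _).
  transitivity ((den v * den t * den t' * den u * den s) ** x').
    by congr (alg_map L _ *: _) => /=; ring.
  by rewrite e; congr (alg_map L _ *: _) => /=; ring.
transitivity ((den u * den s * den s' * den v * den t) ** y').
  by congr (alg_map L _ *: _) => /=; ring.
by rewrite f; congr (alg_map L _ *: _) => /=; ring.
Qed.

Let oppE x s : opp (frac x s) = frac (- x) s.
Proof.
rewrite /opp; case: (repr _) (frac_repr (frac x s)) => x' s' /= /frac_eqP[u e].
by apply/frac_eqP; exists u; rewrite !scalerN e.
Qed.

Let addA : associative add.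
Proof.
elim/frac_ind=> x s; elim/frac_ind=> y t; elim/frac_ind=> z u.
rewrite !addE -denMA; congr frac.
rewrite !scalerDr !alg_scaleM addrA /=; congr (_ + _ + _).
- by congr (alg_map L _ *: _); ring.
- by congr (alg_map L _ *: _); ring.
Qed.

Let addC : commutative add.
Proof.
by elim/frac_ind=> x s; elim/frac_ind=> y t; rewrite !addE addrC denMC.
Qed.

Let add0 : left_id (frac 0 den1) add.
Proof.
by elim/frac_ind=> x s; rewrite addE scaler0 add0r rmorph1 scale1r den1M.
Qed.

Let addN : left_inverse (frac 0 den1) opp add.
Proof.
elim/frac_ind=> x s; rewrite oppE addE -scalerDr addNr scaler0.
by apply/frac_eqP; exists den1; rewrite !scaler0.
Qed.

HB.instance Definition _ := GRing.isZmodule.Build loc addA addC add0 addN.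

Lemma frac0 : frac 0 den1 = 0. Proof. by []. Qed.

Lemma fracD x s y t :
  frac x s + frac y t = frac (den t ** x + den s ** y) (denM s t).
Proof. exact: addE. Qed.

Lemma fracDl x y s : frac x s + frac y s = frac (x + y) s.
Proof. by rewrite fracD -scalerDr frac_cancel. Qed.

Lemma fracN x s : - frac x s = frac (- x) s.
Proof. exact: oppE. Qed.

End Module.

Section Action.
Variable M : lmodType L.

(* For M = L^o this is the multiplication of the localized ring. *)
Definition loc_act (a : loc L^o) (x : loc M) : loc M :=
  frac (((repr a).1 : L) *: (repr x).1) (denM (repr a).2 (repr x).2).

Lemma loc_actE (a : L) (s : denom p) (x : M) (t : denom p) :
  loc_act (frac (a : L^o) s) (frac x t) = frac (a *: x) (denM s t).
Proof.
rewrite /loc_act; case: (repr _) (frac_repr (frac (a : L^o) s)) => b s' /=.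
move=> /frac_eqP[u e].
case: (repr _) (frac_repr (frac x t)) => y t' /= /frac_eqP[v f].
apply/frac_eqP; exists (denM u v).
have {}e : alg_map L (den u * den s) * b = alg_map L (den u * den s') * a.
  by move: e; rewrite !alg_scaleM.
rewrite !alg_scaleM in f *.
transitivity ((alg_map L (den u * den s) * b) *: ((den v * den t) ** y)).
  rewrite -!scalerA -alg_scaleC alg_scaleM; congr (alg_map L _ *: _) => /=; ring.
rewrite e f -!scalerA -alg_scaleC alg_scaleM.
by congr (alg_map L _ *: _) => /=; ring.
Qed.

Lemma loc_act1 : left_id (frac (1 : L^o) den1) loc_act.
Proof. by elim/frac_ind=> x s; rewrite loc_actE scale1r den1M. Qed.

Lemma loc_actDr : right_distributive loc_act +%R.
Proof.
elim/frac_ind=> a s; elim/frac_ind=> x t; elim/frac_ind=> y u.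
rewrite fracD !loc_actE fracD scalerDr -[LHS](frac_cancel s) scalerDr.
rewrite -!(alg_scaleC _ a) !alg_scaleM; congr frac.
by apply: val_inj => /=; ring.
Qed.

Lemma loc_actDl x : {morph loc_act^~ x : a b / a + b}.
Proof.
move=> a b; elim/frac_ind: a => a s; elim/frac_ind: b => b t.
elim/frac_ind: x => x u; rewrite fracD !loc_actE fracD.
rewrite -[LHS](frac_cancel u) scalerDl scalerDr -!scalerA !alg_scaleM.
congr frac; last by apply: val_inj => /=; ring.
by congr (_ + _); congr (alg_map L _ *: _) => /=; ring.
Qed.

End Action.

Lemma loc_actA (M : lmodType L) (a b : loc L^o) (x : loc M) :
  loc_act a (loc_act b x) = loc_act (loc_act a b) x.
Proof.
elim/frac_ind: a => a s; elim/frac_ind: b => b t; elim/frac_ind: x => x u.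
rewrite (loc_actE b t x u) (loc_actE a s ((b : L) *: x)) (loc_actE a s b t).
by rewrite (loc_actE (a * b) (denM s t) x u) scalerA denMA.
Qed.

Definition loc_ring : Type := loc L^o.
HB.instance Definition _ := GRing.Zmodule.on loc_ring.

Let mul : loc_ring -> loc_ring -> loc_ring := @loc_act L^o.
Let one : loc_ring := frac (1 : L^o) den1.

Let mulA : associative mul.
Proof. by move=> a b c; rewrite /mul loc_actA. Qed.
Let mul1l : left_id one mul.
Proof. exact: loc_act1. Qed.
Let mul1r : right_id one mul.
Proof.
elim/frac_ind=> a s; rewrite /mul loc_actE denMC den1M; congr frac.
exact: mulr1.
Qed.
Let mulDl : left_distributive mul +%R.
Proof. by move=> a b c; apply: loc_actDl. Qed.
Let mulDr : right_distributive mul +%R.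
Proof. exact: loc_actDr. Qed.

HB.instance Definition _ := GRing.Zmodule_isPzRing.Build loc_ring
  mulA mul1l mul1r mulDl mulDr.

Definition loc_map (a : L) : loc_ring := frac (a : L^o) den1.

Lemma loc_map_is_zmod_morphism : zmod_morphism loc_map.
Proof. by move=> a b; rewrite /loc_map fracN fracDl. Qed.
Lemma loc_map_is_monoid_morphism : monoid_morphism loc_map.
Proof. by split=> // a b; rewrite /loc_map [RHS]loc_actE den1M. Qed.
HB.instance Definition _ := GRing.isZmodMorphism.Build L loc_ring loc_map
  loc_map_is_zmod_morphism.
HB.instance Definition _ := GRing.isMonoidMorphism.Build L loc_ring loc_map
  loc_map_is_monoid_morphism.

Lemma loc_ring_mapC r (x : loc_ring) :
  (loc_map \o alg_map L) r * x = x * (loc_map \o alg_map L) r.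
Proof.
elim/frac_ind: x => a s; rewrite [LHS]loc_actE [RHS]loc_actE denMC.
congr frac; exact: alg_mapC.
Qed.

Definition loc_alg : algebra R := Algebra loc_ring_mapC.

Section LocModule.
Variable M : lmodType L.

Let scale (a : loc_alg) (x : loc M) : loc M := loc_act (a : loc L^o) x.

Let scaleA a b x : scale a (scale b x) = scale (a * b) x.
Proof. exact: loc_actA. Qed.
Let scale1 : left_id 1 scale.
Proof. exact: loc_act1. Qed.
Let scaleDr : right_distributive scale +%R.
Proof. exact: loc_actDr. Qed.
Let scaleDl x : {morph scale^~ x : a b / a + b}.
Proof. exact: loc_actDl. Qed.

HB.instance Definition _ := GRing.Zmodule_isLmodule.Build loc_alg (loc M)
  scaleA scale1 scaleDr scaleDl.

End LocModule.

Definition loc_alg_map : {rmorphism L -> loc_alg} := loc_map.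

End Localization.

Arguments frac {R L p M} x s.

Section TensorProduct.
Variables (R : comNzRingType) (L : algebra R) (p : prime_idealr R).
Variable M : lmodType L.

Definition self_alg : algebra R :=
  @Algebra R R (GRing.RMorphism.clone R R idfun _) (fun r x => mulrC r x).

Local Notation Rp := (loc_alg self_alg p).

Definition balanced (G : zmodType) (b : Rp -> M -> G) : Prop :=
  [/\ forall u v x, b (u + v) x = b u x + b v x,
      forall u x y, b u (x + y) = b u x + b u y &
      forall (r : R) u x, b (alg_map Rp r * u) x = b u (alg_map L r *: x)].

Definition loc_tens (u : Rp) (x : M) : loc p M :=
  frac (alg_map L (repr (u : loc p self_alg^o)).1 *: x)
       (repr (u : loc p self_alg^o)).2.

Lemma loc_tensE (r : R) (s : denom p) (x : M) :
  loc_tens (frac (r : self_alg^o) s) x = frac (alg_map L r *: x) s.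
Proof.
rewrite /loc_tens; case: (repr _) (frac_repr (frac (r : self_alg^o) s)) => r' s' /=.
move=> /frac_eqP[u e]; apply/frac_eqP; exists u.
by rewrite !alg_scaleM; congr (alg_map L _ *: x); rewrite -!mulrA; apply: e.
Qed.

Lemma loc_tens_balanced : balanced loc_tens.
Proof.
split.
- move=> u v x; elim/frac_ind: u => r s; elim/frac_ind: v => t w.
  by rewrite [_ + _]fracD !loc_tensE fracD !alg_scaleM -scalerDl -rmorphD.
- by move=> u x y; rewrite /loc_tens scalerDr fracDl.
- move=> r u x; elim/frac_ind: u => t w.
  have -> : alg_map Rp r * frac (t : self_alg^o) w = frac (r * t : self_alg^o) w.
    by rewrite [LHS]loc_actE den1M.
  by rewrite !loc_tensE alg_scaleM mulrC.
Qed.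

Lemma loc_tens_universal (G : zmodType) (b : Rp -> M -> G) : balanced b ->
  exists g : loc p M -> G,
    [/\ zmod_morphism g, forall u x, g (loc_tens u x) = b u x &
        forall g', zmod_morphism g' ->
          (forall u x, g' (loc_tens u x) = b u x) -> g' =1 g].
Proof.
move=> [bDl bDr bM].
pose i (s : denom p) : Rp := frac (1 : self_alg^o) s.
have iE (r : R) s : frac (r : self_alg^o) s = alg_map Rp r * i s.
  by rewrite [RHS]loc_actE den1M; congr frac; rewrite [RHS]mulr1.
have iM s t : i s = alg_map Rp (den t) * i (denM t s).
  rewrite -iE; apply/frac_eqP; exists den1; congr (_ *: _).
  exact: (etrans (mulr1 (den t * den s)) (mulrC _ _)).
have tE s x : frac x s = loc_tens (i s) x.
  by rewrite loc_tensE rmorph1 scale1r.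
pose g (u : loc p M) := b (i (repr u).2) (repr u).1.
have gE x s : g (frac x s) = b (i s) x.
  rewrite /g; case: (repr _) (frac_repr (frac x s)) => y t /= /frac_eqP[u e].
  rewrite (iM t (denM u s)) (iM s (denM u t)) !bM.
  have -> : denM (denM u s) t = denM (denM u t) s.
    by apply: val_inj => /=; ring.
  by congr b; move: e; rewrite !alg_scaleM.
have bN v x : b v (- x) = - b v x.
  by apply/eqP; rewrite -addr_eq0 -bDr addNr -(addrK (b v 0) (b v 0)) -bDr addr0 subrr.
exists g; split.
- elim/frac_ind=> x s; elim/frac_ind=> y t.
  by rewrite fracN fracD !gE bDr -!bM -(iM t s) denMC -(iM s t) bN.
- move=> u x; elim/frac_ind: u => r s.
  by rewrite loc_tensE gE iE bM.
- by move=> g' _ g'E; elim/frac_ind=> x s; rewrite gE tE g'E.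
Qed.

End TensorProduct.

Definition finitely_generated (A : pzRingType) (M : lmodType A) : Prop :=
  exists (n : nat) (e : 'I_n -> M),
    forall x : M, exists a : 'I_n -> A, x = \sum_i a i *: e i.

Section CommutativeRings.
Variable R : comNzRingType.

Definition noetherian_ring : Prop :=
  forall I : submodClosed R^o, exists (n : nat) (e : 'I_n -> R),
    (forall i, e i \in I) /\
    (forall x, x \in I -> exists a : 'I_n -> R, x = \sum_i a i * e i).

Definition maximal_ideal (m : idealr R) : Prop :=
  forall I : idealr R, {subset m <= I} -> {subset I <= m}.

Definition semi_local : Prop :=
  exists (n : nat) (m : 'I_n -> idealr R),
    forall I : idealr R, maximal_ideal I -> exists i, I =i m i.

Definition prime_chain (n : nat) (c : 'I_n.+1 -> prime_idealr R) : Prop :=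
  forall i j : 'I_n.+1, (i < j)%N ->
    {subset c i <= c j} /\ ~ {subset c j <= c i}.

Definition krull_dim (d : nat) : Prop :=
  (exists c, @prime_chain d c) /\
  (forall n, (exists c, @prime_chain n c) -> (n <= d)%N).

Definition module_finite (L : algebra R) : Prop :=
  finitely_generated (restrict (alg_map L) L^o).

Definition noetherian_algebra (L : algebra R) : Prop :=
  noetherian_ring /\ module_finite L.

End CommutativeRings.

Section FiniteLength.
Variables (A : pzRingType) (M : lmodType A).

(* N' / N is a simple module. *)
Definition simple_step (N N' : submodClosed M) : Prop :=
  [/\ {subset N <= N'}, ~ {subset N' <= N} &
      forall K : submodClosed M, {subset N <= K} -> {subset K <= N'} ->
        {subset K <= N} \/ {subset N' <= K}].

Definition finite_length : Prop :=
  exists (n : nat) (F : nat -> submodClosed M),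
    [/\ forall x, x \in F 0 -> x = 0,
        forall x, x \in F n &
        forall i, (i < n)%N -> simple_step (F i) (F i.+1)].

End FiniteLength.

Section Classes.
Variable A : pzRingType.

Definition modclass : Type := lmodType A -> Prop.

Definition class_sub (C D : modclass) : Prop := forall X, C X -> D X.

Definition class_eq (C D : modclass) : Prop := forall X, C X <-> D X.

Definition mod_fg : modclass := fun X => finitely_generated X.
Definition mod_fl : modclass := fun X => finite_length X.

Definition isomorphic (X Y : lmodType A) : Prop :=
  exists f : {linear X -> Y}, bijective f.

Definition surjective (X Y : lmodType A) (f : X -> Y) : Prop :=
  forall y, exists x, f x = y.

Definition short_exact (X Y Z : lmodType A) (f : X -> Y) (g : Y -> Z) : Prop :=
  [/\ injective f, surjective g & forall y, g y = 0 <-> exists x, f x = y].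

(* torsion_class D C: C is a torsion class of the abelian category D, which is
   mod_fg (over a Noetherian ring) or mod_fl below. Closure under isomorphisms
   is a case of closure under factor objects. *)
Definition torsion_class (D C : modclass) : Prop :=
  [/\ class_sub C D,
      forall X, D X -> (forall x : X, x = 0) -> C X,
      forall (X Y : lmodType A) (f : {linear X -> Y}),
        C X -> D Y -> surjective f -> C Y &
      forall (X Y Z : lmodType A) (f : {linear X -> Y}) (g : {linear Y -> Z}),
        C X -> D Y -> C Z -> short_exact f g -> C Y].

End Classes.

Section IdealMultiple.
Variables (R : comNzRingType) (L : algebra R) (p : prime_idealr R).
Variable X : lmodType L.

Definition ideal_mul : X -> bool := fun x =>
  `[< exists s : seq (R * X), (forall u, u \in s -> u.1 \in p) /\
        x = \sum_(u <- s) alg_map L u.1 *: u.2 >].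

Let ideal_mul_submod : submod_closed (ideal_mul : {pred X}).
Proof.
split; first by apply/asboolP; exists [::]; rewrite big_nil.
move=> a x y /asboolP[s [sp ->]] /asboolP[t [tp ->]]; apply/asboolP.
exists ([seq (u.1, a *: u.2) | u <- s] ++ t); split.
  by move=> u; rewrite mem_cat => /orP[/mapP[v /sp vp ->]|/tp].
rewrite big_cat big_map scaler_sumr; congr (_ + _).
by apply: eq_bigr => u _; rewrite !scalerA alg_mapC.
Qed.
HB.instance Definition _ := GRing.isSubmodClosed.Build L X ideal_mul
  ideal_mul_submod.

Definition mod_ideal : lmodType L := quotmod (GRing.SubmodClosed.clone L X ideal_mul _).

End IdealMultiple.

Section TorsionClasses.
Variables (R : comNzRingType) (L : algebra R).

Definition loc_class (p : prime_idealr R) (C : modclass L) :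
    modclass (loc_alg L p) :=
  fun Y => exists X, C X /\ isomorphic Y (loc p X).
Arguments loc_class p C Y : clear implicits.

(* p L_p-multiples and p R_p-multiples agree; R acts on X through L_p. *)
Definition psi (p : prime_idealr R) (C : modclass (loc_alg L p)) :
    modclass (loc_alg L p) :=
  fun X => finitely_generated X /\ C (mod_ideal p X).

(* For q contained in p and a module X over L_p, the L_q-module X_q is the
   localization at q of X seen as a module over L. *)
Definition restr (p q : prime_idealr R) (C : modclass (loc_alg L p)) :
    modclass (loc_alg L q) :=
  fun Y => loc_class q
    (fun Z : lmodType L => exists X : lmodType (loc_alg L p),
      psi C X /\ isomorphic Z (restrict (loc_alg_map L p) X)) Y
    /\ finite_length Y.
Arguments restr {p} q C Y.

Definition family : Type := forall p : prime_idealr R, modclass (loc_alg L p).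

Definition family_le (X Y : family) : Prop := forall p, class_sub (X p) (Y p).
Definition family_eq (X Y : family) : Prop := forall p, class_eq (X p) (Y p).

Definition in_T (X : family) : Prop :=
  forall p, torsion_class (@mod_fl (loc_alg L p)) (X p).

Definition in_Tc (X : family) : Prop :=
  in_T X /\
  forall p q : prime_idealr R, {subset q <= p} ->
    class_sub (X q) (restr q (X p)).

Definition tors (T : modclass L) : Prop := torsion_class (@mod_fg L) T.

Definition Phi_t (T : modclass L) : family :=
  fun p Y => loc_class p T Y /\ finite_length Y.

Definition compatible_pair : Prop :=
  forall X : family,
    (exists T, tors T /\ family_eq (Phi_t T) X) <-> in_Tc X.

End TorsionClasses.

(* f is an isomorphism from the poset of the x with P x to the poset of the y
   with Q y. Elements below each other are identified: for classes of modules
   this is extensional equality. *)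
Definition poset_iso (S T : Type) (P : S -> Prop) (leS : S -> S -> Prop)
    (Q : T -> Prop) (leT : T -> T -> Prop) (f : S -> T) : Prop :=
  [/\ forall x, P x -> Q (f x),
      forall x y, P x -> P y -> (leS x y <-> leT (f x) (f y)) &
      forall z, Q z -> exists x, [/\ P x, leT (f x) z & leT z (f x)]].

(* Main.v *)
From HB Require Import structures.
From mathcomp Require Import all_boot all_algebra ring_quotient.
From mathcomp Require Import generic_quotient boolp ring.
Require Import Defs.

(* A torsion class T over L is recovered from its localizations: if X is in T
   but not in T', a factor Z of X is still not in T', while all its proper
   factors are. Every element of R then kills Z or acts injectively on it, so
   p = Ann Z is prime and Z_p is a finite length module. Were Z_p in T'_p, a
   denominator would turn M -> M_p = Z_p, for some M in T', into a nonzero map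
   M -> Z, whose image is a nonzero submodule of Z in T'.

   A compatible family (X^p) is the image of the class T of the X with X_p/pX_p
   in X^p for all p. The point is that each Y in X^q is the localization of a
   module in T. Compatibility provides, for each of the finitely many primes p
   containing q, a finitely generated L-submodule M(p) of Y that spans Y over
   R_q and satisfies the condition at p. In dimension one no prime other than q
   lies between q and two distinct primes p, p'; this gives a outside of p with
   a M(p) inside M(p')_p'. Products a_p of such elements make the sum of the
   a_p M(p) agree with each M(p) after localization at p. *)

Set Implicit Arguments.
Unset Strict Implicit.
Unset Printing Implicit Defensive.

Import GRing.Theory.
Local Open Scope ring_scope.

(** * Submodules, torsion classes and chain conditions *)

(** Membership in the class attached to a family is tested on X_p/pX_p because X_p is merely
    finitely generated, whereas X_p/pX_p is also killed by p and hence of finite length. For Y of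
    finite length nothing is lost: a nonzero factor of Y always has a nonzero submodule that is
    killed by p. The obstacle for surjectivity is that a single lattice in Y must meet the
    conditions at all primes at once. A prime p that does not contain q imposes a trivial one: some
    element of q outside p acts nilpotently on Y, so the localization at p vanishes. The primes
    strictly above q are maximal since dim R = 1, so semi-locality leaves finitely many, and a
    finite product of denominators serves them all. Localizations are seldom handled as fractions:
    an L_p-module V is recognized as X_p through a map from X to V that is onto up to denominators
    and whose kernel is the p-torsion. *)

Section Submodules.
Variables (A : pzRingType) (M : lmodType A).

(** Most submodules below are given by existential formulas (images, sums, spans), so closure is
    stated in [Prop]; [submod_of] then returns to boolean predicates by excluded middle. *)
Record is_submod (P : M -> Prop) : Prop := IsSubmod {
  is_submod0 : P 0;
  is_submodD : forall x y, P x -> P y -> P (x + y);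
  is_submodZ : forall a x, P x -> P (a *: x)
}.

Section Make.
Variables (P : M -> Prop) (hP : is_submod P).

Definition submod_of_pred of is_submod P : M -> bool := fun x => `[< P x >].

Let submod_of_closed : submod_closed (submod_of_pred hP : {pred M}).
Proof.
case: (hP) => P0 PD PZ; split; first exact/asboolP.
by move=> a x y /asboolP Px /asboolP Py; apply/asboolP/PD => //; apply: PZ.
Qed.
HB.instance Definition _ := GRing.isSubmodClosed.Build A M (submod_of_pred hP)
  submod_of_closed.

Definition submod_of : submodClosed M :=
  GRing.SubmodClosed.clone A M (submod_of_pred hP) _.

Lemma submod_ofP x : x \in submod_of <-> P x.
Proof. by split=> [/asboolP|?]; last exact/asboolP. Qed.

Lemma ex_submod : exists N : submodClosed M, forall x, x \in N <-> P x.
Proof. by exists submod_of; apply: submod_ofP. Qed.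
End Make.

Lemma is_submod_mem (N : submodClosed M) : is_submod (fun x => x \in N).
Proof. by split=> [|x y Nx Ny|a x Nx]; rewrite (rpred0, rpredD, rpredZ). Qed.

Lemma is_submod_sum (P : M -> Prop) (I : Type) (s : seq I) (F : I -> M) :
  is_submod P -> (forall i, P (F i)) -> P (\sum_(i <- s) F i).
Proof. by case=> P0 PD _ PF; elim/big_rec: _ => // i x _; apply: PD. Qed.

Lemma submodB (N : submodClosed M) x y : x \in N -> y \in N -> x - y \in N.
Proof. by move=> Nx Ny; rewrite -scaleN1r; apply: rpredD => //; apply: rpredZ. Qed.

Variable N : submodClosed M.
Record submod := Submod { submod_val : M; submod_valP : submod_val \in N }.
HB.instance Definition _ := [isSub for submod_val].
HB.instance Definition _ := [Choice of submod by <:].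
HB.instance Definition _ := [SubChoice_isSubLmodule of submod by <:].

Definition incl : {linear submod -> M} := val.

Lemma incl_inj : injective incl.
Proof. exact: val_inj. Qed.

End Submodules.

Section Linear.
Variables (A : pzRingType).

Definition lin (U V : lmodType A) (f : U -> V) (h : linear f) : {linear U -> V} :=
  HB.pack f (GRing.isLinear.Build A U V _ f h).

Lemma linear_of (U V : lmodType A) (f : U -> V) :
  (forall x y, f (x + y) = f x + f y) -> (forall a x, f (a *: x) = a *: f x) ->
  exists g : {linear U -> V}, forall x, g x = f x.
Proof.
move=> fD fZ; have h : linear f by move=> a x y; rewrite fD fZ.
by exists (lin h).
Qed.

Lemma corestrict (U V : lmodType A) (f : {linear U -> V}) (N : submodClosed V) :
  (forall x, f x \in N) -> exists g : {linear U -> submod N}, forall x, incl N (g x) = f x.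
Proof.
move=> fN; have [||g gE] := @linear_of U (submod N) (fun x => Submod (fN x)).
- by move=> x y; apply: val_inj; rewrite /= linearD.
- by move=> a x; apply: val_inj; rewrite /= linearZ.
by exists g => x; rewrite gE.
Qed.

Lemma factor_through (U V W : lmodType A) (f : {linear U -> V}) (g : {linear U -> W}) :
  surjective f -> (forall x, f x = 0 -> g x = 0) ->
  exists h : {linear V -> W}, forall x, h (f x) = g x.
Proof.
move=> /choice[s fs] fg.
have E x y : f x = f y -> g x = g y.
  by move=> e; apply/eqP; rewrite -subr_eq0 -linearB fg ?linearB ?e ?subrr.
have [||h hE] := @linear_of V W (fun v => g (s v)).
- by move=> x y; rewrite -linearD; apply: E; rewrite linearD !fs.
- by move=> a x; rewrite -linearZ; apply: E; rewrite linearZ !fs.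
by exists h => x; rewrite hE; apply: E; rewrite fs.
Qed.

Lemma lift_through (U V W : lmodType A) (f : {linear V -> W}) (g : {linear U -> W}) :
  injective f -> (forall x, exists y, g x = f y) ->
  exists h : {linear U -> V}, forall x, f (h x) = g x.
Proof.
move=> fI /choice[s gs].
have [||h hE] := @linear_of U V s.
- by move=> x y; apply: fI; rewrite linearD -!gs linearD.
- by move=> a x; apply: fI; rewrite linearZ -!gs linearZ.
by exists h => x; rewrite hE gs.
Qed.

Lemma linear_inj0 (U V : lmodType A) (f : {linear U -> V}) :
  (forall x, f x = 0 -> x = 0) -> injective f.
Proof.
move=> f0 x y e; apply/eqP; rewrite -subr_eq0; apply/eqP/f0.
by rewrite linearB e subrr.
Qed.

Lemma quotmod_surj (M : lmodType A) (N : submodClosed M) : surjective (quotmod_pi N).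
Proof. by elim/quotmod_ind => x; exists x. Qed.

Lemma quotmod_pi0 (M : lmodType A) (N : submodClosed M) x :
  quotmod_pi N x = 0 <-> x \in N.
Proof. by rewrite -(linear0 (quotmod_pi N)) quotmod_piE subr0. Qed.

Lemma is_submod_im (U V : lmodType A) (f : {linear U -> V}) (P : U -> Prop) :
  is_submod P -> is_submod (fun y => exists2 x, P x & y = f x).
Proof.
case=> P0 PD PZ; split; first by exists 0; rewrite ?linear0.
- by move=> _ _ [x Px ->] [y Py ->]; exists (x + y); rewrite ?linearD //; apply: PD.
- by move=> a _ [x Px ->]; exists (a *: x); rewrite ?linearZ //; apply: PZ.
Qed.

Lemma is_submod_pre (U V : lmodType A) (f : {linear U -> V}) (P : V -> Prop) :
  is_submod P -> is_submod (fun x => P (f x)).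
Proof.
case=> P0 PD PZ; split; first by rewrite linear0.
  by move=> x y Px Py; rewrite linearD; apply: PD.
by move=> a x Px; rewrite linearZ; apply: PZ.
Qed.

Lemma is_submodT (M : lmodType A) : is_submod (fun _ : M => True).
Proof. by []. Qed.

Lemma is_submod0P (M : lmodType A) : is_submod (fun x : M => x = 0).
Proof. by split=> // [x y -> ->|a x ->]; rewrite (addr0, scaler0). Qed.

Definition im_sub (U V : lmodType A) (f : {linear U -> V}) : submodClosed V :=
  submod_of (is_submod_im f (is_submodT U)).

Lemma im_subP (U V : lmodType A) (f : {linear U -> V}) y :
  y \in im_sub f <-> exists x, f x = y.
Proof.
by rewrite submod_ofP; split=> [[x _ ->]|[x <-]]; exists x.
Qed.

Lemma im_sub_surj (U V : lmodType A) (f : {linear U -> V}) :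
  exists g : {linear U -> submod (im_sub f)},
    (forall x, incl _ (g x) = f x) /\ surjective g.
Proof.
have [|g gE] := @corestrict U V f (im_sub f); first by move=> x; apply/im_subP; exists x.
exists g; split=> // y; have /im_subP[x fx] := submod_valP y.
by exists x; apply: val_inj; rewrite /= -fx -gE.
Qed.

End Linear.

(** * Finite generation as an induction principle *)

Section Generation.
Variable A : pzRingType.

Lemma fg_surj (X Y : lmodType A) (f : {linear X -> Y}) :
  surjective f -> finitely_generated X -> finitely_generated Y.
Proof.
move=> fs [n [e eP]]; exists n, (fun i => f (e i)) => y.
have [x <-] := fs y; have [a ->] := eP x; exists a.
by rewrite linear_sum; apply: eq_bigr => i _; rewrite linearZ.
Qed.

(** The right-hand side is how finite generation is used below: to prove a submodule property
    everywhere, check it on a list. *)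
Lemma fg_seqP (M : lmodType A) : finitely_generated M <->
  exists s : seq M, forall P, is_submod P -> (forall x, x \in s -> P x) -> forall x, P x.
Proof.
split=> [[n [e eP]]|[s sP]].
  exists [seq e i | i <- enum 'I_n] => P hP Ps x; have [a ->] := eP x.
  apply: is_submod_sum => // i; apply: is_submodZ => //; apply: Ps.
  by apply/map_f; rewrite mem_enum.
exists (size s), (fun i => nth 0 s i); apply: sP; first split.
- by exists (fun => 0); rewrite big1 // => i _; rewrite scale0r.
- move=> x y [a ->] [b ->]; exists (fun i => a i + b i).
  by rewrite -big_split; apply: eq_bigr => i _; rewrite scalerDl.
- move=> b x [a ->]; exists (fun i => b * a i).
  by rewrite scaler_sumr; apply: eq_bigr => i _; rewrite scalerA.
move=> x xs; have hi : (index x s < size s)%N by rewrite index_mem.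
exists (fun i => if i == Ordinal hi then 1 else 0).
rewrite (bigD1 (Ordinal hi)) //= eqxx scale1r nth_index // big1 ?addr0 // => i /negbTE->.
by rewrite scale0r.
Qed.

Definition span (M : lmodType A) (s : seq M) (x : M) : Prop :=
  forall P, is_submod P -> (forall y, y \in s -> P y) -> P x.

Lemma is_submod_span (M : lmodType A) (s : seq M) : is_submod (span s).
Proof.
split=> [|x y sx sy|a x sx] P hP Ps; first exact: is_submod0.
- by apply: is_submodD => //; [apply: sx|apply: sy].
- by apply: is_submodZ => //; apply: sx.
Qed.

Lemma span_mem (M : lmodType A) (s : seq M) x : x \in s -> span s x.
Proof. by move=> xs P _; apply. Qed.

Lemma fg_span (M : lmodType A) (s : seq M) :
  finitely_generated (submod (submod_of (is_submod_span s))).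
Proof.
set N := submod_of _; apply/fg_seqP.
have Ns x : x \in s -> x \in N by move=> xs; apply/(submod_ofP (is_submod_span s)); apply: span_mem.
exists [seq insubd (0 : submod N) x | x <- s] => P hP Ps u.
pose Q x := exists2 v : submod N, P v & incl N v = x.
have hQ : is_submod Q.
  split; first by exists 0 => //; exact: is_submod0.
  - move=> _ _ [v Pv <-] [w Pw <-]; exists (v + w); rewrite ?linearD //.
    exact: is_submodD.
  - by move=> a _ [v Pv <-]; exists (a *: v); rewrite ?linearZ //; apply: is_submodZ.
have [v Pv vE] : Q (incl N u).
  have /(submod_ofP (is_submod_span s)) := submod_valP u; apply=> // x xs.
  exists (insubd (0 : submod N) x); first exact/Ps/map_f.
  by rewrite /= insubdK //; apply: Ns.
by rewrite -(incl_inj vE).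
Qed.

End Generation.

(** * Finite length through rank functions *)

Section Rank.
Variable A : pzRingType.

Definition ACC (M : lmodType A) : Prop := forall P : submodClosed M -> Prop,
  (exists K, P K) ->
  exists K, P K /\ forall K', P K' -> {subset K <= K'} -> {subset K' <= K}.

Definition strictly_monotone (M : lmodType A) (d : submodClosed M -> nat) : Prop :=
  forall K K' : submodClosed M,
    {subset K <= K'} -> ~ {subset K' <= K} -> (d K < d K')%N.

(** Any strictly monotone function to the naturals replaces the length: both chain conditions follow
    by choosing a member of extremal rank, the rank of M itself being an upper bound. *)
Definition ranked (M : lmodType A) : Prop :=
  exists d : submodClosed M -> nat, strictly_monotone d.

Lemma ex_min (T : Type) (P : T -> Prop) (d : T -> nat) : (exists x, P x) ->
  exists x, P x /\ forall y, P y -> (d x <= d y)%N.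
Proof.
move=> [x Px]; pose Q n := `[< exists2 x, P x & d x = n >].
have exQ : exists n, Q n by exists (d x); apply/asboolP; exists x.
case: (ex_minnP exQ) => n /asboolP[y Py dy] min; exists y; split=> // z Pz.
by rewrite dy min //; apply/asboolP; exists z.
Qed.

Lemma ex_max (T : Type) (P : T -> Prop) (d : T -> nat) m :
  (forall x, P x -> (d x <= m)%N) -> (exists x, P x) ->
  exists x, P x /\ forall y, P y -> (d y <= d x)%N.
Proof.
move=> dm exP; have [x [Px min]] := ex_min (fun x => m - d x)%N exP.
exists x; split=> // y Py; have := min y Py.
by rewrite leq_subCl subKn //; apply: dm.
Qed.

Lemma ranked_DCC (M : lmodType A) (P : submodClosed M -> Prop) : ranked M ->
  (exists K, P K) ->
  exists K, P K /\ forall K', P K' -> {subset K' <= K} -> {subset K <= K'}.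
Proof.
move=> [d dP] exP; have [K [PK min]] := ex_min d exP; exists K; split=> // K' PK' sK.
by apply: contrapT => /(dP _ _ sK); rewrite ltnNge min.
Qed.

Lemma ranked_ACC (M : lmodType A) : ranked M -> ACC M.
Proof.
move=> [d dP] P exP; have [T TP] := ex_submod (is_submodT M).
have T_ (K : submodClosed M) : {subset K <= T} by move=> x _; apply/TP.
have [[K [PK TK]]|noT] := pselect (exists K, P K /\ {subset T <= K}).
  by exists K; split=> // K' _ _ x _; apply/TK/TP.
have [|K [PK max]] := @ex_max _ P d (d T) _ exP.
  move=> K PK; apply: ltnW; apply: dP => // TK; apply: noT; by exists K.
exists K; split=> // K' PK' sK.
by apply: contrapT => /(dP _ _ sK); rewrite ltnNge max.
Qed.

(* The rank of K counts the i at which K meets F i.+1 outside of F i. *)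
Lemma rank_of_flag (M : lmodType A) (F : nat -> M -> Prop) (n : nat) :
  (forall x, F 0 x -> x = 0) -> (forall x, F n x) ->
  (forall i (K : submodClosed M) x, (i < n)%N -> x \in K -> F i.+1 x -> ~ F i x ->
    forall y, F i.+1 y -> exists2 z, z \in K & F i (y - z)) ->
  ranked M.
Proof.
move=> F0 Fn Fstep.
pose m (K : submodClosed M) i := `[< exists x, [/\ x \in K, F i.+1 x & ~ F i x] >].
exists (fun K => \sum_(i < n) m K i)%N => K K' sK nK.
have sm i : m K i -> m K' i.
  by move=> /asboolP[x [Kx Fx nFx]]; apply/asboolP; exists x; split=> //; apply: sK.
(* Since [m K i] implies [m K' i], the failure of d K < d K' makes the two agree for every i < n.
   Induction on i then corrects an element of K' by one of K, layer by layer. *)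
rewrite ltnNge; apply/negP => le_d; apply: nK.
have em i : (i < n)%N -> m K' i -> m K i.
  move=> lt_in m'i; apply: contraLR le_d => nmi; rewrite -ltnNge.
  rewrite (bigD1 (Ordinal lt_in)) // [X in (_ < X)%N](bigD1 (Ordinal lt_in)) //=.
  rewrite m'i (negbTE nmi) add0n ltnS leq_sum // => j _.
  by have := sm j; case: (m K j) => // ->.
have main i : (i <= n)%N -> forall x, x \in K' -> F i x -> x \in K.
  elim: i => [_ x _ /F0->|i IH lt_in y K'y Fy]; first exact: rpred0.
  have [Fiy|nFiy] := pselect (F i y); first by apply: IH => //; apply: ltnW.
  have /em/asboolP[] // : m K' i by apply/asboolP; exists y.
  move=> x [Kx Fx nFx]; have [z Kz Fyz] := Fstep i K x lt_in Kx Fx nFx y Fy.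
  rewrite -(subrK z y); apply: rpredD => //; apply: IH => //; first exact: ltnW.
  by apply: submodB => //; apply: sK.
by move=> x K'x; apply: (main n).
Qed.

Lemma is_submod_add (M : lmodType A) (P Q : M -> Prop) :
  is_submod P -> is_submod Q -> is_submod (fun z => exists x y, [/\ P x, Q y & z = x + y]).
Proof.
move=> hP hQ; split.
- by exists 0, 0; split; rewrite ?addr0 //; apply: is_submod0.
- move=> _ _ [x [y [Px Qy ->]]] [x' [y' [Px' Qy' ->]]].
  by exists (x + x'), (y + y'); split; rewrite 1?addrACA //; apply: is_submodD.
- move=> a _ [x [y [Px Qy ->]]].
  by exists (a *: x), (a *: y); split; rewrite ?scalerDr //; apply: is_submodZ.
Qed.

Lemma is_submod_line (M : lmodType A) (x : M) : is_submod (fun y => exists a, y = a *: x).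
Proof.
split; first by exists 0; rewrite scale0r.
- by move=> _ _ [a ->] [b ->]; exists (a + b); rewrite scalerDl.
- by move=> b _ [a ->]; exists (b * a); rewrite scalerA.
Qed.

Lemma finite_length_ranked (M : lmodType A) : finite_length M -> ranked M.
Proof.
move=> [n [F [F0 Fn Fs]]]; apply: (@rank_of_flag M (fun i x => x \in F i) n) => //.
move=> i K x lt_in Kx Fx nFx y Fy; have [sF _ sFs] := Fs i lt_in.
have [G GP] := ex_submod (is_submod_add (is_submod_mem (F i)) (is_submod_line x)).
have [||s1|s2] := sFs G.
- move=> z Fz; apply/GP; exists z, 0; rewrite addr0; split=> //.
  by exists 0; rewrite scale0r.
- move=> z /GP[u [_ [Fu [a ->] ->]]].
  by apply: rpredD; [apply: sF|apply: rpredZ].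
- case: nFx; apply: s1; apply/GP; exists 0, x; rewrite add0r rpred0.
  by split=> //; exists 1; rewrite scale1r.
have /GP[u [_ [Fu [a ->] ->]]] := s2 y Fy; exists (a *: x); first exact: rpredZ.
by rewrite addrK.
Qed.

(* Below K choose a submodule of maximal rank among the proper ones. *)
Lemma ranked_finite_length (M : lmodType A) : ranked M -> finite_length M.
Proof.
move=> [d dP].
suff main (n : nat) (K : submodClosed M) : (d K < n)%N -> exists n (F : nat -> submodClosed M),
    [/\ forall x, x \in F 0%N -> x = 0, F n = K &
      forall i, (i < n)%N -> simple_step (F i) (F i.+1)].
  have [T TP] := ex_submod (is_submodT M); have [n [F [F0 Fn Fs]]] := main _ T (ltnSn _).
  by exists n, F; split=> // x; rewrite Fn; apply/TP.
elim: n K => // n IH K; rewrite ltnS => le_dK.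
have [K0|nK0] := pselect (forall x, x \in K -> x = 0); first by exists 0, (fun => K).
pose P (K' : submodClosed M) := {subset K' <= K} /\ ~ {subset K <= K'}.
have [||K1 [[sK1 nK1] max]] := @ex_max _ P d (d K).
- by move=> K' [sK nK]; apply: ltnW; apply: dP.
- have [Z ZP] := ex_submod (is_submod0P M); exists Z; split; first by move=> x /ZP->; apply: rpred0.
  by move=> s; apply: nK0 => x /s /ZP.
have lt_dK1 : (d K1 < n)%N by apply: leq_trans (dP _ _ sK1 nK1) _.
have [m [F [F0 Fm Fs]]] := IH K1 lt_dK1.
exists m.+1, (fun i => if (i <= m)%N then F i else K); split=> [x /F0//||i].
  by rewrite ltnn.
rewrite ltnS => le_im; rewrite le_im; case: ltnP => [lt_im|ge_im]; first exact: Fs.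
have -> : i = m by apply/eqP; rewrite eqn_leq le_im.
rewrite Fm; split=> // K2 s12 s2; have [s21|n12] := pselect {subset K2 <= K1}; first by left.
right; apply: contrapT => n2; have := max K2 (conj s2 n2).
by rewrite leqNgt (dP _ _ s12 n12).
Qed.

Lemma finite_lengthP (M : lmodType A) : finite_length M <-> ranked M.
Proof. by split; [apply: finite_length_ranked|apply: ranked_finite_length]. Qed.

(** Preimages under a surjection keep strict inclusions strict, so a rank on X induces one on Y. *)
Lemma finite_length_surj (X Y : lmodType A) (f : {linear X -> Y}) :
  surjective f -> finite_length X -> finite_length Y.
Proof.
move=> fs /finite_lengthP[d dP]; apply/finite_lengthP.
pose pre (K : submodClosed Y) := submod_of (is_submod_pre f (is_submod_mem K)).
exists (fun K => d (pre K)) => K K' sK nK; apply: dP.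
  by move=> x /submod_ofP Kx; apply/submod_ofP/sK.
move=> s; apply: nK => y; have [x <-] := fs y => K'x.
by apply/(submod_ofP (is_submod_pre f (is_submod_mem K)))/s/submod_ofP.
Qed.

Lemma finite_length_fg (M : lmodType A) : finite_length M -> finitely_generated M.
Proof.
move=> /finite_lengthP/ranked_ACC acc.
have [|K [[s sK] max]] := acc (fun K => exists s, forall x, x \in K <-> span s x).
  by exists (submod_of (is_submod_span [::])), [::]; apply: submod_ofP.
apply/fg_seqP; exists s => P hP Ps x.
have [K' K'P] := ex_submod (is_submod_span (x :: s)).
suff sx : span s x by apply: sx.
apply/sK; apply: (max K'); first by exists (x :: s).
  move=> y /sK sy; apply/K'P => Q hQ Qs; apply: sy => // z zs.
  by apply: Qs; rewrite inE zs orbT.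
by apply/K'P; apply: span_mem; rewrite inE eqxx.
Qed.

Lemma finite_length0 (M : lmodType A) : (forall x : M, x = 0) -> finite_length M.
Proof.
move=> M0; exists 0%N, (fun => submod_of (is_submod0P M)); split=> // x.
by apply/submod_ofP.
Qed.
End Rank.

(** * Minimal factors outside a torsion class *)

Section Torsion.
Variables (A : pzRingType) (D C : modclass A).
Hypothesis Dsurj : forall (X Y : lmodType A) (f : {linear X -> Y}),
  surjective f -> D X -> D Y.
Hypothesis tC : torsion_class D C.

Lemma torsion_surj (X Y : lmodType A) (f : {linear X -> Y}) :
  surjective f -> C X -> C Y.
Proof.
case: tC => CD _ Cq _ fs CX; apply: (Cq _ _ f) => //.
by apply: (Dsurj fs); apply: CD.
Qed.

(** The closure axiom applies to the image of f, which is a factor of X and therefore in C. *)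
Lemma torsion_ext (X Y Z : lmodType A) (f : {linear X -> Y}) (g : {linear Y -> Z}) :
  C X -> D Y -> C Z -> surjective g -> (forall x, g (f x) = 0) ->
  (forall y, g y = 0 -> exists x, f x = y) -> C Y.
Proof.
case: (tC) => _ _ _ Ce CX DY CZ gs gf0 kg; have [h [hE hs]] := im_sub_surj f.
apply: (Ce _ _ _ (incl (im_sub f)) g) => //; first exact: torsion_surj hs CX.
split=> // [|y]; first exact: incl_inj.
split=> [/kg[x <-]|[u <-]]; first by exists (h x); rewrite hE.
by have [x <-] := hs u; rewrite hE gf0.
Qed.

(** Take Z = M/K with K maximal such that M/K is not in C. A nonzero map from W in C to Z would make
    Z an extension of a proper factor of Z by the image of W, both in C. An endomorphism of Z with
    nonzero kernel factors through a proper factor of Z, which is in C, so it is zero by the same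
    argument. *)
Lemma torsion_minimal (M : lmodType A) : ACC M -> D M -> ~ C M ->
  exists (Z : lmodType A) (f : {linear M -> Z}),
    [/\ surjective f, D Z, ~ C Z,
        forall (W : lmodType A) (g : {linear W -> Z}), C W -> forall w, g w = 0 &
        forall g : {linear Z -> Z}, (forall z, g z = 0) \/ injective g].
Proof.
move=> acc DM nCM; have [|K [nCK max]] := acc (fun K => ~ C (quotmod K)).
  have [Z0 Z0P] := ex_submod (is_submod0P M); exists Z0 => CZ; apply: nCM.
  have [|x /quotmod_pi0/Z0P-> //|h hE] := @factor_through A _ _ _ (quotmod_pi Z0) idfun.
    exact: quotmod_surj.
  by apply: (@torsion_surj _ _ h) CZ => y; exists (quotmod_pi Z0 y); rewrite hE.
pose pi : {linear M -> quotmod K} := quotmod_pi K; have pis : surjective pi := @quotmod_surj A M K.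
have CK' (K' : submodClosed M) : {subset K <= K'} -> ~ {subset K' <= K} ->
    C (quotmod K') by move=> sK nK; apply: contrapT => /max/(_ sK).
have key (W : lmodType A) (g : {linear W -> quotmod K}) : C W -> forall w, g w = 0.
  move=> CW w; apply: contrapT => gw; apply: nCK.
  have [K' K'P] := ex_submod (is_submod_pre pi (is_submod_im g (is_submodT W))).
  have sK : {subset K <= K'}.
    by move=> x Kx; apply/K'P; exists 0; rewrite // linear0; apply/quotmod_pi0.
  have [||h hE] := @factor_through A _ _ _ pi (quotmod_pi K') => //.
    by move=> x /quotmod_pi0 Kx; apply/quotmod_pi0/sK.
  apply: (@torsion_ext _ _ _ g h CW) => //.
  - exact: (Dsurj pis).
  - apply: CK' => // s; apply: gw; have [x gx] := pis (g w).
    by rewrite -gx; apply/quotmod_pi0/s/K'P; exists w.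
  - by move=> y; have [x <-] := quotmod_surj y; exists (pi x); apply: hE.
  - move=> v; have [x gx] := pis (g v); rewrite -gx hE.
    by apply/quotmod_pi0/K'P; exists v.
  - move=> y; have [x <-] := pis y; rewrite hE => /quotmod_pi0/K'P[v _ e].
    by exists v; rewrite -e.
exists (quotmod K), pi; split=> //; first exact: (Dsurj pis).
move=> g; have [kg|/existsNP[z /not_implyP[gz z0]]] := pselect (forall z, g z = 0 -> z = 0).
  by right; apply: linear_inj0.
left; have [K' K'P] := ex_submod (is_submod_pre pi (is_submod_pre g (is_submod0P _))).
have sK : {subset K <= K'}.
  by move=> x Kx; apply/K'P; rewrite (_ : pi x = 0) ?linear0 //; apply/quotmod_pi0.
have [|x|h hE] := @factor_through A _ _ _ (quotmod_pi K') (g \o pi).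
- exact: quotmod_surj.
- by move=> /quotmod_pi0/K'P.
move=> y; have [x <-] := pis y; have /= <- := hE x; apply: key; apply: CK' => // s.
apply: z0; have [u uz] := pis z; rewrite -uz; apply/quotmod_pi0/s/K'P.
by rewrite uz.
Qed.

End Torsion.

(** * Generation over the base ring *)

Section AlgebraModules.
Variables (R : comNzRingType) (L : algebra R).
Local Notation "r ** x" := (alg_map _ r *: x) (at level 40).

Section Generators.
Variable M : lmodType L.

(** Closure over R rather than L: leading coefficients and Nakayama's argument need coefficients in
    the commutative ring. *)
Record is_rsub (P : M -> Prop) : Prop := IsRsub {
  is_rsub0 : P 0;
  is_rsubD : forall x y, P x -> P y -> P (x + y);
  is_rsubZ : forall r x, P x -> P (r ** x)
}.

Lemma is_rsub_sum (P : M -> Prop) (I : Type) (s : seq I) (F : I -> M) :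
  is_rsub P -> (forall i, P (F i)) -> P (\sum_(i <- s) F i).
Proof. by case=> P0 PD _ PF; elim/big_rec: _ => // i x _; apply: PD. Qed.

Lemma is_rsubN (P : M -> Prop) x : is_rsub P -> P x -> P (- x).
Proof. by case=> _ _ PZ /(PZ (-1)); rewrite rmorphN rmorph1 scaleN1r. Qed.

Lemma is_rsubB (P : M -> Prop) x y : is_rsub P -> P x -> P y -> P (x - y).
Proof. by move=> hP Px Py; apply: is_rsubD => //; apply: is_rsubN. Qed.

(** With generators indexed by [nat], one sequence e yields the whole flag of spans as n grows,
    which suits induction on n. *)
Definition rspan (e : nat -> M) (n : nat) (x : M) : Prop :=
  exists r : nat -> R, x = \sum_(j < n) r j ** e j.

Lemma is_rsub_rspan e n : is_rsub (rspan e n).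
Proof.
split; first by exists (fun => 0); rewrite big1 // => i _; rewrite rmorph0 scale0r.
- move=> _ _ [r ->] [s ->]; exists (fun i => r i + s i).
  by rewrite -big_split; apply: eq_bigr => i _; rewrite rmorphD scalerDl.
- move=> t _ [r ->]; exists (fun i => t * r i).
  by rewrite scaler_sumr; apply: eq_bigr => i _; rewrite rmorphM scalerA.
Qed.

Lemma rspan_gen e n j : (j < n)%N -> rspan e n (e j).
Proof.
move=> lt_jn; exists (fun i => if i == j then 1 else 0).
rewrite (bigD1 (Ordinal lt_jn)) //= eqxx rmorph1 scale1r big1 ?addr0 // => i.
by rewrite -val_eqE /= => /negbTE->; rewrite rmorph0 scale0r.
Qed.

Lemma rspanS e n x :
  rspan e n.+1 x <-> exists r y, rspan e n y /\ x = y + r ** e n.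
Proof.
split=> [[r ->]|[r [_ [[s ->] ->]]]].
  by exists (r n), (\sum_(j < n) r j ** e j); split; [exists r|rewrite big_ord_recr].
exists (fun i => if (i < n)%N then s i else r).
rewrite big_ord_recr /= ltnn; congr (_ + _).
by apply: eq_bigr => i _; rewrite ltn_ord.
Qed.

Lemma rspan0 e x : rspan e 0 x -> x = 0.
Proof. by move=> [r ->]; rewrite big_ord0. Qed.

End Generators.

Hypothesis finL : module_finite L.

Lemma ex_rgenerators (M : lmodType L) (s : seq M) :
  exists t : seq M, forall P, is_rsub P -> (forall x, x \in t -> P x) ->
    forall x (a : L), x \in s -> P (a *: x).
Proof.
have [n [l lP]] := finL; exists [seq (l i : L) *: x | i <- enum 'I_n, x <- s].
move=> P hP Pt x a xs; have [r ar] := lP a.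
have -> : a *: x = \sum_i r i ** ((l i : L) *: x).
  rewrite [a]ar scaler_suml; apply: eq_bigr => i _; rewrite scalerA; congr (_ *: _).
apply: is_rsub_sum => // i; apply: is_rsubZ => //; apply: Pt.
by apply/allpairsP; exists (i, x); rewrite mem_enum.
Qed.

Lemma fg_rspan (M : lmodType L) : finitely_generated M ->
  exists (e : nat -> M) n, forall x, rspan e n x.
Proof.
move=> /fg_seqP[s sP]; have [t tP] := ex_rgenerators s.
exists (nth 0 t), (size t) => x; have hR := is_rsub_rspan (nth 0 t) (size t).
(* Quantifying over a turns an R-submodule into an L-submodule, as [sP] demands. *)
suff : forall a : L, rspan (nth 0 t) (size t) (a *: x).
  by move=> /(_ 1); rewrite scale1r.
apply: (sP (fun x => forall a : L, rspan (nth 0 t) (size t) (a *: x))) => [|y ys a].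
  split=> [a|y z Py Pz a|b y Py a]; first by rewrite scaler0; apply: is_rsub0.
  - by rewrite scalerDr; apply: is_rsubD.
  - by rewrite scalerA; apply: Py.
apply: tP => // z zt; rewrite -(nth_index 0 zt); apply: rspan_gen.
by rewrite index_mem.
Qed.

End AlgebraModules.

(** * Ascending chains over a Noetherian algebra *)

Section Noetherian.
Variables (R : comNzRingType) (L : algebra R).
Local Notation "r ** x" := (alg_map _ r *: x) (at level 40).

(** Without a maximal member, choice builds a strictly increasing chain in P; the finitely many
    generators of its union already lie in one term. *)
Lemma noetherian_ACC : noetherian_ring R -> ACC R^o.
Proof.
move=> noeR P [K0 PK0]; apply: contrapT => nmax.
have step (K : {K | P K}) : exists K' : {K | P K},
    {subset sval K <= sval K'} /\ ~ {subset sval K' <= sval K}.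
  apply: contrapT => nK; apply: nmax; exists (sval K); split=> [|K' PK' sK].
    exact: svalP.
  by apply: contrapT => nK'; apply: nK; exists (exist _ K' PK').
have [f fP] := choice step; pose c i := sval (iter i f (exist _ K0 PK0)).
have cS i : {subset c i <= c i.+1} by move=> x cx; apply: (fP _).1.
have cmono i j : (i <= j)%N -> {subset c i <= c j}.
  move=> le_ij; rewrite -(subnK le_ij); elim: (j - i)%N => // k IH x /IH; exact: cS.
have hU : is_submod (fun x : R^o => exists i, x \in c i).
  split; first by exists 0%N; apply: rpred0.
    move=> x y [i cx] [j cy]; exists (maxn i j); apply: rpredD.
      by apply: cmono cx; apply: leq_maxl.
    by apply: cmono cy; apply: leq_maxr.
  by move=> a x [i cx]; exists i; apply: rpredZ.
have [U UP] := ex_submod hU; have [n [e [eU eP]]] := noeR U.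
have /choice[g gP] : forall i : 'I_n, exists k, e i \in c k by move=> i; apply/UP.
have ec i : e i \in c (\max_i g i)%N.
  by apply: cmono (gP i); apply: (leq_bigmax (F := g)).
have [_] := fP (iter (\max_i g i)%N f (exist _ K0 PK0)); apply=> x cx.
have /eP[a ->] : x \in U by apply/UP; exists (\max_i g i).+1.
by apply: rpred_sum => i _; apply: (@rpredZ _ R^o).
Qed.

(* As in Hilbert's basis theorem: a submodule is determined, among those that
   contain it, by its ideals of leading coefficients. *)
Lemma ACC_fg (M : lmodType L) : noetherian_algebra L -> finitely_generated M -> ACC M.
Proof.
move=> [/noetherian_ACC accR finL] /(fg_rspan finL)[e [n eP]] P exP.
have hI (K : submodClosed M) i : is_submod
    (fun r : R^o => exists2 y, rspan e i y & y + r ** e i \in K).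
  split.
  - exists 0; first by apply: is_rsub0; apply: is_rsub_rspan.
    by rewrite (rmorph0 (alg_map L)) scale0r addr0 rpred0.
  - move=> r s [y ey Ky] [z ez Kz]; exists (y + z).
      by apply: is_rsubD => //; apply: is_rsub_rspan.
    by rewrite (rmorphD (alg_map L)) scalerDl addrACA rpredD.
  - move=> r s [y ey Ky]; exists (r ** y).
      by apply: is_rsubZ => //; apply: is_rsub_rspan.
    by rewrite (rmorphM (alg_map L)) -scalerA -scalerDr rpredZ.
pose I K i := submod_of (hI K i).
have IP K i r : r \in I K i <-> exists2 y, rspan e i y & y + r ** e i \in K.
  exact: submod_ofP.
have Imono (K K' : submodClosed M) i : {subset K <= K'} -> {subset I K i <= I K' i}.
  by move=> sK r /IP[y ey Ky]; apply/IP; exists y => //; apply: sK.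
(* The coefficient ideals are maximized one index at a time. Enlarging K for the index k keeps the
   ideals of smaller index, since those are already maximal. *)
have main k : exists K, P K /\ forall K', P K' -> {subset K <= K'} ->
    forall i, (i < k)%N -> {subset I K' i <= I K i}.
  elim: k => [|k [K [PK Kmax]]]; first by case: exP => K PK; exists K; split.
  pose Q (J : submodClosed R^o) := exists K', [/\ P K', {subset K <= K'} & J = I K' k].
  have [|J [[K1 [PK1 sK ->]] max]] := accR Q; first by exists (I K k), K; split.
  exists K1; split=> // K' PK' sK1 i; rewrite ltnS leq_eqVlt => /predU1P[->|lt_ik].
    apply: max; last exact: Imono.
    by exists K'; split=> // x /sK/sK1.
  move=> r Ir; apply: (Imono _ _ _ sK).
  by apply: (Kmax K') Ir => // x /sK/sK1.
have [K [PK Kmax]] := main n; exists K; split=> // K' PK' sK x K'x.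
have {}Kmax := Kmax K' PK' sK.
(* As the ideals agree, K contains an element with the same leading coefficient; subtracting it
   leaves an element of K' in the shorter span. *)
have claim i : (i <= n)%N -> forall y, rspan e i y -> y \in K' -> y \in K.
  elim: i => [_ y /rspan0->|i IH lt_in y]; first by move=> _; apply: rpred0.
  move=> /rspanS[r [z [ez ->]]] K'z; have /IP[w ew Kw] : r \in I K i.
    by apply: (Kmax i lt_in); apply/IP; exists z.
  rewrite (_ : z + _ = z - w + (w + r ** e i)); last by rewrite addrA subrK.
  apply: rpredD => //; apply: IH; first exact: ltnW.
    by apply: is_rsubB => //; apply: is_rsub_rspan.
  have -> : z - w = z + r ** e i - (w + r ** e i) by rewrite opprD addrACA subrr addr0.
  by apply: submodB => //; apply: sK.
exact: (claim n).
Qed.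
End Noetherian.

(** * Localization *)

Section Localize.
Variables (R : comNzRingType) (L : algebra R) (p : prime_idealr R).
Local Notation "r ** x" := (alg_map _ r *: x) (at level 40).
Local Notation Lp := (loc_alg L p).
Local Notation res := (restrict (loc_alg_map L p)).

Lemma loc_alg_frac (a : Lp) : exists (b : L) (s : denom p),
  alg_map Lp (den s) * a = loc_alg_map L p b.
Proof.
elim/frac_ind: a => b s; exists b, s; rewrite [LHS]loc_actE.
by rewrite den1M /loc_alg_map /= /loc_map -[RHS](frac_cancel s) denMC den1M.
Qed.

Lemma den_inv (s : denom p) : exists a : Lp, a * alg_map Lp (den s) = 1.
Proof.
exists (frac (1 : L^o) s); rewrite [LHS]loc_actE denMC den1M scale1r.
rewrite -[RHS](frac_cancel s) denMC den1M; congr frac; exact/esym/mulr1.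
Qed.

Lemma den_surj (V : lmodType Lp) (s : denom p) (v : V) : exists w, den s ** w = v.
Proof.
have [a as1] := den_inv s; exists (a *: v).
by rewrite scalerA alg_mapC as1 scale1r.
Qed.

Lemma den_inj (V : lmodType Lp) (s : denom p) (v : V) : den s ** v = 0 -> v = 0.
Proof.
have [a as1 e] := den_inv s.
by rewrite -(scale1r v) -as1 -scalerA e scaler0.
Qed.

Lemma res_den_surj (V : lmodType Lp) (s : denom p) (v : res V) : exists w, den s ** w = v.
Proof. exact: (@den_surj V). Qed.

Lemma res_den_inj (V : lmodType Lp) (s : denom p) (v : res V) : den s ** v = 0 -> v = 0.
Proof. exact: (@den_inj V). Qed.

Lemma is_submod_loc (V : lmodType Lp) (P : res V -> Prop) :
  is_submod P -> (forall (s : denom p) v, P (den s ** v) -> P v) ->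
  is_submod (P : V -> Prop).
Proof.
case=> P0 PD PZ Pden; split=> // a x Px; have [b [s sb]] := loc_alg_frac a.
apply: (Pden s); rewrite [X in P X]scalerA.
by have -> : loc_alg_map L p (alg_map L (den s)) * a = loc_alg_map L p b; last exact: PZ.
Qed.

Lemma is_submod_res (V : lmodType Lp) (P : V -> Prop) :
  is_submod P -> is_submod (P : res V -> Prop).
Proof. by case=> P0 PD PZ; split=> // a x; apply: PZ. Qed.

Lemma is_submod_den (V : lmodType Lp) (P : V -> Prop) (s : denom p) v :
  is_submod P -> P (den s ** v) -> P v.
Proof.
move=> hP; have [a as1] := den_inv s.
by move=> /(is_submodZ hP a); rewrite scalerA as1 scale1r.
Qed.

(** A denominator s of a annihilates f(ax) - a f(x), and s acts injectively on W. *)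
Lemma linear_loc (V W : lmodType Lp) (f : {linear res V -> res W}) :
  exists g : {linear V -> W}, forall v, g v = f v.
Proof.
apply: linear_of => [x y|a x]; first exact: (raddfD f).
have [b [s sb]] := loc_alg_frac a.
have sv (U : lmodType Lp) (v : U) : alg_map Lp (den s) *: (a *: v) = loc_alg_map L p b *: v.
  by rewrite scalerA sb.
have e3 := linearZZ f (alg_map L (den s)) (a *: x : V).
have e4 := linearZZ f b x.
apply/eqP; rewrite -subr_eq0; apply/eqP/(@den_inj W s); rewrite scalerBr sv.
apply/eqP; rewrite subr_eq0; apply/eqP.
exact: etrans (esym e3) (etrans (congr1 f (sv V x)) e4).
Qed.

Lemma linear_res (V W : lmodType Lp) (f : {linear V -> W}) :
  exists g : {linear res V -> res W}, forall v, g v = f v.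
Proof.
apply: linear_of => [x y|a x]; first exact: (raddfD f).
exact: (linearZZ f _ _).
Qed.

(** Surjectivity up to denominators: the image of f spans V over R_p. If the kernel is also the
    p-torsion of X, then V is X_p, see [isomorphic_locP]. *)
Definition generic (X : lmodType L) (V : lmodType Lp) (f : X -> res V) : Prop :=
  forall v : res V, exists (s : denom p) x, den s ** v = f x.

Section LocLift.
Variables (X : lmodType L) (V W : lmodType Lp).
Variables (f : {linear X -> res V}) (g : {linear X -> res W}).
Hypothesis fg : generic f.

Lemma loc_lift : (forall x, f x = 0 -> g x = 0) ->
  exists h : {linear V -> W}, forall x, h (f x) = g x.
Proof.
move=> kfg.
(* The graph of the wanted map: v and w are f x and g x divided by the same s. It is single-valued
   because ker f is contained in ker g and denominators act injectively on W. *)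
pose rel (v : res V) (w : res W) :=
  exists (s : denom p) x, den s ** v = f x /\ den s ** w = g x.
have ex v : exists w, rel v w.
  have [s [x sx]] := fg v; have [w sw] := res_den_surj s (g x : res W).
  by exists w, s, x.
have [h hP] := choice ex.
have rel0 w : rel 0 w -> w = 0.
  move=> [s [x [fx gx]]]; apply: (@res_den_inj _ s); rewrite gx; apply: kfg.
  by rewrite -fx scaler0.
have relD v w v' w' : rel v w -> rel v' w' -> rel (v + v') (w + w').
  move=> [s [x [fx gx]]] [t [y [fy gy]]]; exists (denM s t), (den t ** x + den s ** y).
  rewrite !linearD !linearZZ -fx -gx -fy -gy !scalerDr !scalerA -!rmorphM /=.
  by rewrite [den t * _]mulrC.
have relZ a v w : rel v w -> rel (a *: v) (a *: w).
  move=> [s [x [fx gx]]]; exists s, (a *: x).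
  by rewrite !linearZZ -fx -gx !scalerA alg_mapC.
have uniq v w w' : rel v w -> rel v w' -> w = w'.
  move=> vw /(relZ (-1)) vw'; apply/eqP; rewrite -subr_eq0; apply/eqP/rel0.
  by rewrite -(subrr v) -scaleN1r -[- w']scaleN1r; apply: relD.
have [||k kh] := @linear_of L (res V) (res W) h.
- by move=> x y; apply: (uniq (x + y)) => //; apply: relD.
- by move=> a x; apply: (uniq (a *: x)) => //; apply: relZ.
have [l lk] := linear_loc k; exists l => x; rewrite lk kh; apply: (uniq (f x)) => //.
by exists den1, x; rewrite !rmorph1 !scale1r.
Qed.

Lemma loc_lift_surj (h : {linear V -> W}) : (forall x, h (f x) = g x) ->
  generic g -> surjective h.
Proof.
move=> hE gg w; have [s [x sx]] := gg w; have [v sv] := res_den_surj s (f x : res V).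
exists v; apply/eqP; rewrite -subr_eq0; apply/eqP/(@den_inj W s).
rewrite scalerBr -(linearZZ h _ _) [X in h X](sv : _ = _) hE.
by rewrite [X in _ - X](sx : _ = _) subrr.
Qed.

Lemma loc_lift_inj (h : {linear V -> W}) : (forall x, h (f x) = g x) ->
  (forall x, g x = 0 -> f x = 0) -> injective h.
Proof.
move=> hE kgf; apply: linear_inj0 => v hv; have [s [x sx]] := fg v.
apply: (@den_inj V s); rewrite [LHS](sx : _ = _); apply: kgf; rewrite -hE -sx.
by rewrite [LHS](linearZZ h _ _) hv scaler0.
Qed.

Lemma loc_iso : (forall x, f x = 0 <-> g x = 0) -> generic g -> isomorphic V W.
Proof.
move=> kfg gg; have [|h hE] := loc_lift; first by move=> x /kfg.
have /choice[k hk] := loc_lift_surj hE gg; exists h; exists k => // v.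
by apply: (@loc_lift_inj h); rewrite // => x /kfg.
Qed.
End LocLift.

Section Frac1.
Variable M : lmodType L.

Let frac1_fun (x : M) : res (loc p M) := frac x den1.

Let frac1_linear : linear frac1_fun.
Proof.
move=> a x y; rewrite /frac1_fun -fracDl; congr (_ + _).
by rewrite -[RHS]/(loc_act (frac (a : L^o) den1) (frac x den1)) loc_actE den1M.
Qed.

Definition frac1 : {linear M -> res (loc p M)} := lin frac1_linear.

Lemma frac1_eq0 x : frac1 x = 0 <-> exists s : denom p, den s ** x = 0.
Proof.
split=> [/frac_eqP[u]|[s sx]]; first by rewrite rmorph1 scale1r !scaler0; exists u.
by apply/frac_eqP; exists s; rewrite rmorph1 scale1r !scaler0.
Qed.

Lemma den_frac (s : denom p) (x : M) : den s ** (frac x s : res (loc p M)) = frac1 x.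
Proof.
rewrite -[LHS]/(loc_act (frac (alg_map L (den s) : L^o) den1) (frac x s)) loc_actE.
by rewrite den1M -[RHS](frac_cancel s) denMC den1M.
Qed.

Lemma frac1_generic : generic frac1.
Proof. by elim/frac_ind=> x s; exists s, x; apply: den_frac. Qed.
End Frac1.

Lemma isomorphic_refl (A : pzRingType) (M : lmodType A) : isomorphic M M.
Proof. by exists idfun; exists id. Qed.

Lemma isomorphic_locP (M : lmodType L) (V : lmodType Lp) : isomorphic V (loc p M) <->
  exists f : {linear M -> res V}, generic f /\
    forall x, f x = 0 <-> exists s : denom p, den s ** x = 0.
Proof.
split=> [[h [k hk kh]]|[f [gf kf]]]; last first.
  apply: (loc_iso gf); last exact: frac1_generic.
  by move=> x; rewrite kf frac1_eq0.
have [||k' k'E] := @linear_of _ _ _ k.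
- by move=> x y; rewrite -[x in LHS]kh -[y in LHS]kh -linearD hk.
- by move=> a x; rewrite -[x in LHS]kh -linearZ hk.
have [k1 k1E] := linear_res k'; exists (k1 \o frac1 M)%FUN; split=> [v|x] /=.
  have [s [x sx]] := frac1_generic (h v : res (loc p M)); exists s, x.
  have := congr1 k1 sx; rewrite linearZZ => <-; congr (_ *: _).
  by rewrite k1E k'E; apply/esym/hk.
rewrite -frac1_eq0 k1E k'E; split=> [e|e]; last by have := congr1 k' e; rewrite k'E => ->; apply: linear0.
by apply: etrans (esym (kh _)) _; apply: etrans (congr1 h e) _; apply: linear0.
Qed.

End Localize.

(** * The factor M/pM *)

Section IdealQuotient.
Variables (R : comNzRingType) (L : algebra R) (p : prime_idealr R).
Local Notation "r ** x" := (alg_map _ r *: x) (at level 40).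

Definition smul (M : lmodType L) (r : R) : {linear M -> M} :=
  lin (fun a x y => etrans (scalerDr (alg_map L r) (a *: x) y)
                           (congr1 (+%R^~ (r ** y)) (alg_scaleC r a x))).

Lemma smulE (M : lmodType L) r (x : M) : smul M r x = r ** x.
Proof. by []. Qed.

Lemma is_submod_ideal (X : lmodType L) : is_submod (fun x : X => ideal_mul p x).
Proof.
split.
- by apply/asboolP; exists [::]; rewrite big_nil.
- move=> x y /asboolP[s [sp ->]] /asboolP[t [tp ->]]; apply/asboolP; exists (s ++ t).
  by split=> [u|]; rewrite ?big_cat // mem_cat => /orP[/sp|/tp].
- move=> a x /asboolP[s [sp ->]]; apply/asboolP; exists [seq (u.1, a *: u.2) | u <- s].
  split=> [u /mapP[v /sp vp ->] //|]; rewrite big_map scaler_sumr.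
  by apply: eq_bigr => u _; rewrite alg_scaleC.
Qed.

Lemma ideal_mul_gen (X : lmodType L) r (x : X) : r \in p -> ideal_mul p (r ** x).
Proof.
move=> pr; apply/asboolP; exists [:: (r, x)]; rewrite big_seq1; split=> // u.
by rewrite inE => /eqP->.
Qed.

Lemma ideal_mul_ind (X : lmodType L) (P : X -> Prop) : is_submod P ->
  (forall r x, r \in p -> P (r ** x)) -> forall x, ideal_mul p x -> P x.
Proof.
move=> hP Pp x /asboolP[s [sp ->]]; elim: s sp => [|u s IH] sp.
  by rewrite big_nil; apply: is_submod0.
rewrite big_cons; apply: is_submodD => //.
  by apply: Pp; apply: sp; rewrite mem_head.
by apply: IH => v vs; apply: sp; rewrite inE vs orbT.
Qed.

Definition mod_ideal_pi (X : lmodType L) : {linear X -> mod_ideal p X} :=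
  GRing.Linear.clone _ _ _ _ (@quotmod_pi _ X _) _.

Lemma mod_ideal_pi0 (X : lmodType L) (x : X) : mod_ideal_pi X x = 0 <-> ideal_mul p x.
Proof. exact: quotmod_pi0. Qed.

Lemma mod_ideal_surj (X : lmodType L) : surjective (mod_ideal_pi X).
Proof. exact: quotmod_surj. Qed.

Lemma mod_ideal_killed (X : lmodType L) r (u : mod_ideal p X) : r \in p -> r ** u = 0.
Proof.
move=> pr; have [x <-] := mod_ideal_surj u.
by rewrite -linearZZ; apply/mod_ideal_pi0/ideal_mul_gen.
Qed.

Lemma mod_ideal_map (X Y : lmodType L) (f : {linear X -> Y}) :
  exists g : {linear mod_ideal p X -> mod_ideal p Y},
    forall x, g (mod_ideal_pi X x) = mod_ideal_pi Y (f x).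
Proof.
apply: (@factor_through _ _ _ _ (mod_ideal_pi X) (mod_ideal_pi Y \o f)).
  exact: mod_ideal_surj.
move=> x /mod_ideal_pi0 Ix; apply/mod_ideal_pi0; move: x Ix.
apply: (ideal_mul_ind (is_submod_pre f (is_submod_ideal Y))) => r x pr.
by rewrite linearZZ; apply: ideal_mul_gen.
Qed.

Lemma mod_ideal_map_surj (X Y : lmodType L) (f : {linear X -> Y}) : surjective f ->
  exists g : {linear mod_ideal p X -> mod_ideal p Y}, surjective g.
Proof.
move=> fs; have [g gE] := mod_ideal_map f; exists g => v.
have [y <-] := mod_ideal_surj v; have [x <-] := fs y.
by exists (mod_ideal_pi X x).
Qed.

End IdealQuotient.

(** * Finite length modules over L_p *)

Section LocalModules.
Variables (R : comNzRingType) (L : algebra R) (p : prime_idealr R).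
Hypothesis finL : module_finite L.
Local Notation "r ** x" := (alg_map _ r *: x) (at level 40).
Local Notation Lp := (loc_alg L p).
Local Notation res := (restrict (loc_alg_map L p)).

Definition local_span (W : lmodType L) (e : nat -> W) n (x : W) : Prop :=
  exists s : denom p, rspan e n (den s ** x).

Lemma is_rsub_local_span (W : lmodType L) (e : nat -> W) n : is_rsub (local_span e n).
Proof.
have hR := is_rsub_rspan e n; split.
- by exists den1; rewrite scaler0; apply: is_rsub0.
- move=> x y [s sx] [t ty]; exists (denM s t); rewrite scalerDr.
  apply: is_rsubD => //; rewrite rmorphM -scalerA; last exact: is_rsubZ.
  by rewrite alg_scaleC; apply: is_rsubZ.
- by move=> r x [s sx]; exists s; rewrite alg_scaleC; apply: is_rsubZ.
Qed.

Lemma local_span_den (W : lmodType L) (e : nat -> W) n (s : denom p) x :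
  local_span e n (den s ** x) -> local_span e n x.
Proof.
by move=> [t tx]; exists (denM t s); rewrite rmorphM -scalerA.
Qed.

Lemma rspan_local_span (W : lmodType L) (e : nat -> W) n x : rspan e n x -> local_span e n x.
Proof. by exists den1; rewrite rmorph1 scale1r. Qed.

Lemma fg_local_span (W : lmodType Lp) : finitely_generated W ->
  exists (e : nat -> res W) n, forall x, local_span e n x.
Proof.
move=> /fg_seqP[s sP]; have [t tP] := ex_rgenerators finL (s : seq (res W)).
exists (nth 0 t), (size t) => x; have hR := is_rsub_local_span (nth 0 t) (size t).
pose P (y : res W) := forall b : L, local_span (nth 0 t) (size t) (b *: y).
suff /(_ 1) : P x by rewrite scale1r.
apply: (sP P) => [|y ys b].
  apply: is_submod_loc; first split=> [b|y z Py Pz b|a y Py b].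
  - by rewrite scaler0; apply: is_rsub0.
  - by rewrite scalerDr; apply: is_rsubD.
  - by rewrite scalerA; apply: Py.
  by move=> d v Pv b; apply: (@local_span_den _ _ _ d); rewrite alg_scaleC; apply: Pv.
apply: tP => // z zt; apply: rspan_local_span.
by rewrite -(nth_index 0 zt); apply: rspan_gen; rewrite index_mem.
Qed.

Lemma not_mem_denom (r : R) : r \notin p -> exists s : denom p, den s = r.
Proof. by move=> pr; exists (Denom pr). Qed.

(** W is a finite-dimensional vector space over the residue field of p; the spans of initial
    segments of a generating sequence form a flag for [rank_of_flag]. *)
Lemma killed_finite_length (W : lmodType Lp) : finitely_generated W ->
  (forall r (x : res W), r \in p -> r ** x = 0) -> finite_length W.
Proof.
move=> /fg_local_span[e [n eP]] kill; apply/finite_lengthP.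
apply: (@rank_of_flag _ W (fun i (x : res W) => local_span e i x) n) => //.
  by move=> x [s /rspan0]; apply: res_den_inj.
move=> i K x lt_in Kx [s sx] nFx y [t ty].
have /rspanS[r [x' [ex' sxE]]] := sx; have /rspanS[c [y' [ey' tyE]]] := ty.
have [pr|npr] := boolP (r \in p).
  by case: nFx; exists s; rewrite sxE (kill r) // addr0.
have [d dr] := not_mem_denom npr.
(* The coefficient r of e i in s x lies outside p, so it can be inverted: the multiple z of x is
   chosen so that y - z has no e i term left. *)
have [z zE] := res_den_surj (denM d t) ((c * den s) ** (x : res W)).
exists z.
  apply: (is_submod_den (s := denM d t) (is_submod_mem K)).
  by rewrite [X in X \in K]zE; apply: rpredZ.
exists (denM d t); have hR := is_rsub_rspan e i.
rewrite scalerBr zE /= dr !rmorphM -!scalerA tyE sxE !scalerDr !scalerA -!rmorphM.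
rewrite [r * c]mulrC opprD addrACA subrr addr0.
by apply: is_rsubB => //; apply: is_rsubZ.
Qed.

(** Generators are removed from the end. Writing e n = r y and s y = z + c e n gives (s - r c) e n =
    r z, where s - r c is outside p; so the last generator is redundant. *)
Lemma Nakayama (W : lmodType Lp) (r : R) : finitely_generated W -> r \in p ->
  (forall x : res W, exists y, x = r ** y) -> forall x : W, x = 0.
Proof.
move=> /fg_local_span[e [n eP]] pr rW; elim: n eP => [eP x|n IH eP].
  by have [s /rspan0] := eP x; apply: res_den_inj.
apply: IH => x; have hR := is_rsub_rspan e n.
have en : local_span e n (e n).
  have [y ey] := rW (e n); have [s /rspanS[c [z [ez sy]]]] := eP y.
  have npt : den s - r * c \notin p.
    apply/negP => h; have := denP s; rewrite -(subrK (r * c) (den s)).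
    by rewrite rpredD // mulrC idealMr.
  have [t tE] := not_mem_denom npt; exists t.
  rewrite tE rmorphB scalerBl {1}ey alg_scaleM mulrC -alg_scaleM sy scalerDr.
  by rewrite alg_scaleM addrK; apply: is_rsubZ.
have [s /rspanS[c [z [ez sx]]]] := eP x; apply: (@local_span_den _ _ _ s).
have hS := is_rsub_local_span e n.
by rewrite sx; apply: is_rsubD => //; [apply: rspan_local_span|apply: is_rsubZ].
Qed.

(* Descending chain condition for the submodules uW with u in U. *)
Lemma min_multiple (W : lmodType Lp) (U : R -> Prop) : finite_length W ->
  (exists u, U u) -> exists u, U u /\
    forall r, U (r * u) -> forall x : res W, exists y, u ** x = (r * u) ** y.
Proof.
move=> /finite_lengthP rkW [u0 Uu0].
pose P (K : submodClosed W) := exists2 u, U u & K = im_sub (smul W u).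
have [|K [[u Uu ->] min]] := ranked_DCC (P := P) rkW.
  by exists (im_sub (smul W u0)), u0.
exists u; split=> // r Uru x.
have h : {subset im_sub (smul W u) <= im_sub (smul W (r * u))}.
  apply: min; first by exists (r * u).
  move=> y /im_subP[x' <-].
  by apply/im_subP; exists (r ** (x' : W)); rewrite !smulE !alg_scaleM mulrC.
have /im_subP[y ye] : u ** (x : W) \in im_sub (smul W (r * u)).
  by apply: h; apply/im_subP; exists x.
by exists y; apply: esym ye.
Qed.

(** Choose k with r^k W minimal. Then multiplication by r maps r^k W onto itself, and [Nakayama]
    makes it zero. *)
Lemma finite_length_nilpotent (W : lmodType Lp) r : finite_length W -> r \in p ->
  exists k, forall x : res W, r ^+ k ** x = 0.
Proof.
move=> flW pr; have [|_ [[k ->] min]] := @min_multiple W (fun u => exists k, u = r ^+ k) flW.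
  by exists 1, 0%N.
exists k => x; set V := submod (im_sub (smul W (r ^+ k))).
have [g [gE gs]] := im_sub_surj (smul W (r ^+ k)).
have V0 : forall v : V, v = 0.
  apply: (@Nakayama _ r _ pr); first exact: fg_surj gs (finite_length_fg flW).
  move=> v; have [y <-] := gs v; have [|z zE] := min r _ y; first by exists k.+1; rewrite exprS.
  exists (g z); apply: incl_inj; rewrite gE.
  apply: etrans (zE : _ = (alg_map Lp (r * r ^+ k)) *: (z : W)) _.
  rewrite -alg_scaleM -[RHS]/(incl _ (alg_map Lp r *: g z)) linearZZ gE.
  by [].
by have := gE x; rewrite (V0 (g x)) linear0 => /esym.
Qed.

(** Choose uW minimal among the nonzero multiples. If r u W were nonzero for some r in p, it would
    equal uW, against [Nakayama]. *)
Lemma finite_length_socle (W : lmodType Lp) : finite_length W -> (exists x : W, x <> 0) ->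
  exists u, (exists x : res W, u ** x <> 0) /\
    forall r, r \in p -> forall x : res W, (r * u) ** x = 0.
Proof.
move=> flW [x0 nx0].
have [|u [[x ux] min]] := @min_multiple W (fun u => exists x : res W, u ** x <> 0) flW.
  by exists 1, x0; rewrite rmorph1 scale1r.
exists u; split=> [|r pr y]; first by exists x.
apply: contrapT => ruy; apply: ux; set V := submod (im_sub (smul W u)).
have [g [gE gs]] := im_sub_surj (smul W u).
have V0 : forall v : V, v = 0.
  apply: (@Nakayama _ r _ pr); first exact: fg_surj gs (finite_length_fg flW).
  move=> v; have [z <-] := gs v; have [|w wE] := min r _ z; first by exists y.
  exists (g w); apply: incl_inj; rewrite gE.
  apply: etrans (wE : _ = (alg_map Lp (r * u)) *: (w : W)) _.
  rewrite -alg_scaleM -[RHS]/(incl _ (alg_map Lp r *: g w)) linearZZ gE.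
  by [].
by have := gE x; rewrite (V0 (g x)) linear0 => /esym.
Qed.

Lemma mod_ideal_finite_length (V : lmodType Lp) : finitely_generated V ->
  finite_length (mod_ideal p V).
Proof.
move=> fgV; apply: killed_finite_length.
  exact: fg_surj (@mod_ideal_surj _ _ p V) fgV.
by move=> r x pr; apply: mod_ideal_killed.
Qed.

Lemma finite_length_closed (X Y : lmodType Lp) (f : {linear X -> Y}) :
  surjective f -> mod_fl X -> mod_fl Y.
Proof. exact: finite_length_surj. Qed.

(* A finite length module Z has u in R with u Z nonzero and p u Z = 0, which
   makes u Z a factor of Z / pZ. *)
Lemma torsion_mod_ideal (C : modclass Lp) (Y : lmodType Lp) :
  torsion_class (@mod_fl Lp) C -> finite_length Y -> C (mod_ideal p Y) -> C Y.
Proof.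
move=> tC flY CY; apply: contrapT => nCY.
have [Z [f [fs flZ nCZ CZ0 _]]] := torsion_minimal (@finite_length_closed) tC
  (ranked_ACC (finite_length_ranked flY)) flY nCY.
have [g gs] := mod_ideal_map_surj p fs.
have CZ := torsion_surj (@finite_length_closed) tC gs CY.
have [|u [[x ux] pu]] := finite_length_socle flZ.
  apply: contrapT => Z0; apply: nCZ; case: tC => _ C0 _ _; apply: C0 => // x.
  by apply: contrapT => x0; apply: Z0; exists x.
(* Multiplication by u induces a nonzero map from Z/pZ to Z, which [CZ0] forbids since Z/pZ is in
   C. *)
have [||h hE] := @factor_through _ _ _ _ (mod_ideal_pi p Z) (smul Z u).
- exact: mod_ideal_surj.
- move=> z /mod_ideal_pi0; move: z.
  apply: ideal_mul_ind; first exact: is_submod_pre (is_submod0P Z).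
  by move=> r z pr; rewrite smulE alg_scaleM mulrC; apply: pu.
by apply: ux; apply: etrans (esym (hE x)) _; apply: CZ0.
Qed.

End LocalModules.

Section Lifting.
Variable A : pzRingType.

Lemma fg_ext (X Y Z : lmodType A) (f : {linear X -> Y}) (g : {linear Y -> Z}) :
  finitely_generated X -> finitely_generated Z -> surjective g ->
  (forall y, g y = 0 -> exists x, f x = y) -> finitely_generated Y.
Proof.
move=> /fg_seqP[s sP] /fg_seqP[t tP] /choice[k gk] kg; apply/fg_seqP.
exists ([seq f x | x <- s] ++ [seq k z | z <- t]) => P hP Pst y.
have Pf x : P (f x).
  apply: (sP (fun x => P (f x))) x; first exact: is_submod_pre.
  by move=> x xs; apply: Pst; rewrite mem_cat map_f.
have [y' Py' e] : exists2 y', P y' & g y = g y'.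
  apply: (tP (fun z => exists2 y', P y' & z = g y')); first exact: is_submod_im.
  by move=> z zt; exists (k z); rewrite // -?gk; apply: Pst; rewrite mem_cat map_f ?orbT.
have [|x fx] := kg (y - y'); first by rewrite linearB e subrr.
by rewrite -(subrK y' y) -fx; apply: is_submodD.
Qed.

Lemma fg_lift (U V : lmodType A) (g : {linear U -> V}) (N : submodClosed V) :
  finitely_generated (submod N) -> (forall v, v \in N -> exists u, g u = v) ->
  exists E : submodClosed U, finitely_generated (submod E) /\
    forall v, v \in N <-> exists2 u, u \in E & v = g u.
Proof.
move=> /fg_seqP[s sP] Ng.
have /choice[k kP] : forall v : submod N, exists u, g u = incl N v.
  by move=> v; apply: Ng; apply: submod_valP.
exists (submod_of (is_submod_span [seq k v | v <- s])); split; first exact: fg_span.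
move=> v; split=> [Nv|[u /submod_ofP su ->]].
  apply: (sP (fun w => exists2 u, u \in _ & incl N w = g u)) (Submod Nv) => [|w ws].
    exact: (is_submod_pre (incl N) (is_submod_im g (is_submod_mem _))).
  exists (k w); rewrite ?kP //.
  by apply/submod_ofP; apply: span_mem; apply: map_f.
apply: (su (fun u => g u \in N)); first exact: is_submod_pre (is_submod_mem N).
by move=> y /mapP[w ws ->]; rewrite kP; apply: submod_valP.
Qed.

End Lifting.

(** * The reduction X_p/pX_p *)

Section Reduction.
Variables (R : comNzRingType) (L : algebra R) (p : prime_idealr R).
Local Notation "r ** x" := (alg_map _ r *: x) (at level 40).
Local Notation Lp := (loc_alg L p).
Local Notation res := (restrict (loc_alg_map L p)).

Lemma fg_generic (X : lmodType L) (V : lmodType Lp) (f : {linear X -> res V}) :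
  generic f -> finitely_generated X -> finitely_generated V.
Proof.
move=> fg /fg_seqP[s sP]; apply/fg_seqP; exists [seq f x : V | x <- s] => P hP Ps v.
have [d [x dx]] := fg v; apply: (is_submod_den (s := d) hP).
rewrite [X in P X](dx : _ = _); apply: (sP (fun y => P (f y))).
  exact: is_submod_pre (is_submod_res hP).
by move=> y ys; apply: Ps; apply: map_f.
Qed.

Lemma fg_loc (X : lmodType L) : finitely_generated X -> finitely_generated (loc p X).
Proof. by apply: fg_generic; apply: frac1_generic. Qed.

Definition reduction (X : lmodType L) : lmodType Lp := mod_ideal p (loc p X).

(** For the implication from left to right, the fractions that a denominator carries to the image of
    an element of pX form an L_p-submodule containing p X_p. *)
Lemma ideal_mul_frac1 (X : lmodType L) (x : X) :
  ideal_mul p (frac1 p X x : loc p X) <-> exists s : denom p, ideal_mul p (den s ** x).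
Proof.
split=> [Ix|[s Isx]]; last first.
  apply: (is_submod_den (s := s) (is_submod_ideal p _)).
  have -> : den s ** (frac1 p X x : loc p X) = frac1 p X (den s ** x).
    exact/esym/(linearZZ (frac1 p X)).
  move: (den s ** x) Isx; apply: ideal_mul_ind.
    exact: is_submod_pre (is_submod_res (is_submod_ideal p (loc p X))).
  move=> r y pr; have -> : frac1 p X (r ** y) = r ** (frac1 p X y : loc p X).
    exact: (linearZZ (frac1 p X)).
  exact: ideal_mul_gen.
pose P (v : res (loc p X)) :=
  exists (s : denom p) (y : X), ideal_mul p y /\ den s ** v = frac1 p X y.
have [s [y [Iy sx]]] : P (frac1 p X x).
  have hI := is_submod_ideal p X.
  apply: (@ideal_mul_ind R Lp p (loc p X) P) Ix => [|r v pr].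
    apply: (@is_submod_loc R L p (loc p X) P); first split.
    - by exists den1, 0; split; [apply: (is_submod0 hI)|rewrite scaler0 linear0].
    - move=> v w [s [y [Iy sv]]] [t [z [Iz tw]]].
      exists (denM s t), (den t ** y + den s ** z); split.
        by apply: (is_submodD hI); apply: (is_submodZ hI).
      rewrite linearD !linearZZ -sv -tw !scalerDr !scalerA -!rmorphM /=.
      by rewrite [den t * _]mulrC.
    - move=> a v [s [y [Iy sv]]]; exists s, (a *: y); split; first exact: (is_submodZ hI).
      by rewrite alg_scaleC sv linearZZ.
    - move=> t v [s [y [Iy sv]]]; exists (denM s t), y; split=> //.
      by rewrite rmorphM -scalerA.
  have [s [y sy]] := frac1_generic (v : res (loc p X)).
  exists s, (r ** y); split; first exact: ideal_mul_gen.
  by rewrite linearZZ -sy; exact: (alg_scaleC (L := L) (M := res (loc p X))).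
have /frac1_eq0[t tE] : frac1 p X (den s ** x - y) = 0.
  by rewrite linearB linearZZ sx subrr.
exists (denM t s); rewrite rmorphM -scalerA.
have -> : den t ** (den s ** x) = den t ** y.
  by apply/eqP; rewrite -subr_eq0 -scalerBr tE.
by apply: (is_submodZ (is_submod_ideal p X)).
Qed.

Lemma reductionP (X : lmodType L) : exists f : {linear X -> res (reduction X)},
  generic f /\ forall x, f x = 0 <-> exists s : denom p, ideal_mul p (den s ** x).
Proof.
have [g gE] := linear_res (mod_ideal_pi p (loc p X)).
exists (g \o frac1 p X)%FUN; split=> [v|x] /=.
  have [w wv] := mod_ideal_surj (v : reduction X).
  have [s [x sx]] := frac1_generic (w : res (loc p X)); exists s, x.
  by have := congr1 g sx; rewrite linearZZ (gE w) [X in _ *: X](wv : _ = _).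
by rewrite -ideal_mul_frac1 gE; apply: mod_ideal_pi0.
Qed.

(** Both sides receive generic maps from X with the same kernel. This shows that the reduction of X
    in T is the localization of X/pX, a factor of X and so again in T. *)
Lemma reduction_iso (X : lmodType L) : isomorphic (reduction X) (loc p (mod_ideal p X)).
Proof.
have [f [fg kf]] := reductionP X.
apply: (@loc_iso _ _ _ X _ _ f (frac1 p _ \o mod_ideal_pi p X) fg) => [x|v] /=.
  rewrite kf frac1_eq0.
  by split=> -[s sx]; exists s; move: sx; rewrite -linearZZ mod_ideal_pi0.
have [s [y sy]] := frac1_generic v; have [x xy] := mod_ideal_surj y.
by exists s, x; rewrite sy /= -xy.
Qed.

Lemma reduction_map (X Y : lmodType L) (f : {linear X -> Y})
    (a : {linear X -> res (reduction X)}) (b : {linear Y -> res (reduction Y)}) :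
  generic a -> (forall x, a x = 0 <-> exists s : denom p, ideal_mul p (den s ** x)) ->
  (forall x, b x = 0 <-> exists s : denom p, ideal_mul p (den s ** x)) ->
  exists g : {linear reduction X -> reduction Y}, forall x, g (a x) = b (f x).
Proof.
move=> ga ka kb; apply: (loc_lift (g := b \o f) ga) => x /ka[s Isx].
apply/kb; exists s; rewrite -linearZZ; move: (den s ** x) Isx.
apply: (ideal_mul_ind (is_submod_pre f (is_submod_ideal p Y))) => r y pr.
by rewrite linearZZ; apply: ideal_mul_gen.
Qed.

Lemma reduction_surj (X Y : lmodType L) (f : {linear X -> Y}) : surjective f ->
  exists g : {linear reduction X -> reduction Y}, surjective g.
Proof.
move=> fs; have [a [ga ka]] := reductionP X; have [b [gb kb]] := reductionP Y.
have [g gE] := reduction_map f ga ka kb; exists g.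
apply: (loc_lift_surj (f := a) (g := b \o f) gE) => v.
by have [s [y sy]] := gb v; have [x xy] := fs y; exists s, x; rewrite /= xy.
Qed.

Hypothesis finL : module_finite L.

Lemma reduction_finite_length (X : lmodType L) : finitely_generated X ->
  finite_length (reduction X).
Proof. by move=> fgX; apply/(mod_ideal_finite_length finL)/fg_loc. Qed.

(** Reduction is right exact, which is all that [torsion_ext] asks for. *)
Lemma reduction_ext (C : modclass Lp) (X Y Z : lmodType L)
    (f : {linear X -> Y}) (g : {linear Y -> Z}) :
  torsion_class (@mod_fl Lp) C -> finitely_generated Y -> short_exact f g ->
  C (reduction X) -> C (reduction Z) -> C (reduction Y).
Proof.
move=> tC fgY [fi gs ex] CX CZ.
have [a [ga ka]] := reductionP X; have [b [gb kb]] := reductionP Y.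
have [c [gc kc]] := reductionP Z.
have [f' f'E] := reduction_map f ga ka kb; have [g' g'E] := reduction_map g gb kb kc.
apply: (torsion_ext (@finite_length_closed _ L p) tC (f := f') (g := g') CX) => //.
- exact: reduction_finite_length.
- apply: (loc_lift_surj (f := b) (g := c \o g) g'E) => v.
  by have [s [y sy]] := gc v; have [x xy] := gs y; exists s, x; rewrite /= xy.
- move=> v; have [s [x sx]] := ga v; apply: (den_inj (s := s)).
  have := congr1 (fun t => g' (f' t)) sx; rewrite f'E g'E (_ : g (f x) = 0).
    rewrite linear0 => e; apply: etrans e.
    by rewrite -linearZZ -linearZZ.
  by apply/ex; exists x.
(* Exactness in the middle: t g(y) lies in pZ and lifts to y' in pY; then t y - y' comes from some
   x, and v is the image of x up to the denominator t s. *)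
- move=> v g'v; have [s [y sy]] := gb v.
  have cy : c (g y) = 0.
    rewrite -g'E -sy; apply: etrans (linearZZ g' (alg_map Lp (den s)) v) _.
    by rewrite g'v scaler0.
  have /kc[t tgy] := cy.
  have [y' Iy' gy'] : exists2 y', ideal_mul p y' & den t ** g y = g y'.
    move: (den t ** g y) tgy; apply: ideal_mul_ind.
      exact: is_submod_im (is_submod_ideal p Y).
    move=> r z pr; have [w <-] := gs z; exists (r ** w); last by rewrite linearZZ.
    exact: ideal_mul_gen.
  have /ex[x fx] : g (den t ** y - y') = 0 by rewrite linearB linearZZ gy' subrr.
  have by' : b y' = 0 by apply/kb; exists den1; rewrite rmorph1 scale1r.
  have bfx : b (f x) = den (denM t s) ** (v : res (reduction Y)).
    by rewrite fx linearB by' subr0 linearZZ -sy rmorphM scalerA.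
  have [w wE] := den_surj (denM t s) (a x : reduction X).
  exists w; apply/eqP; rewrite -subr_eq0; apply/eqP/(den_inj (s := denM t s)).
  by rewrite scalerBr -linearZZ wE f'E [X in X - _](bfx : _ = _) subrr.
Qed.

End Reduction.

(** * From torsion classes to compatible families *)

Section PhiT.
Variables (R : comNzRingType) (L : algebra R).
Hypothesis noethL : noetherian_algebra L.
Local Notation "r ** x" := (alg_map _ r *: x) (at level 40).
Local Notation Lp p := (loc_alg L p).
Local Notation res p := (restrict (loc_alg_map L p)).

(** An L-submodule N of Y with N_p = Y. Working inside Y replaces the choice of a module together
    with an isomorphism. *)
Definition lattice p (Y : lmodType (Lp p)) (N : submodClosed (res p Y)) : Prop :=
  forall y : res p Y, exists s : denom p, den s ** y \in N.

Lemma lattice_iso p (Y : lmodType (Lp p)) (N : submodClosed (res p Y)) :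
  lattice N -> isomorphic Y (loc p (submod N)).
Proof.
move=> latN; apply/isomorphic_locP; exists (incl N); split=> [y|x].
  by have [s Ny] := latN y; exists s, (Submod Ny).
split=> [e|[s sx]]; first by exists den1; apply: incl_inj; rewrite linearZZ e scaler0 linear0.
by apply: (res_den_inj (s := s)); rewrite -linearZZ sx linear0.
Qed.

Section TorsionClass.
Variables (T : modclass L).
Hypothesis torsT : tors T.

Let fgS (X Y : lmodType L) (f : {linear X -> Y}) : surjective f -> mod_fg X -> mod_fg Y.
Proof. exact: fg_surj. Qed.

Lemma tors_fg X : T X -> finitely_generated X.
Proof. by case: torsT => TD _ _ _; apply: TD. Qed.

(** If Y is M_p with M in T, the image of M in Y is a lattice, and it is in T as a factor of M. *)
Lemma loc_class_lattice p (Y : lmodType (Lp p)) : loc_class T Y <->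
  exists N : submodClosed (res p Y), lattice N /\ T (submod N).
Proof.
split=> [[M [TM /isomorphic_locP[f [fg _]]]]|[N [latN TN]]]; last first.
  by exists (submod N); split=> //; apply: lattice_iso.
have [g [_ gs]] := im_sub_surj f; exists (im_sub f); split.
  by move=> y; have [s [x sx]] := fg y; exists s; apply/im_subP; exists x.
exact: (torsion_surj fgS torsT gs).
Qed.

Lemma loc_class_surj p (Y Y' : lmodType (Lp p)) (f : {linear Y -> Y'}) :
  surjective f -> loc_class T Y -> loc_class T Y'.
Proof.
move=> fs /loc_class_lattice[N [latN TN]]; have [F FE] := linear_res f.
have [g [gE gs]] := im_sub_surj (F \o incl N)%FUN.
apply/loc_class_lattice; exists (im_sub (F \o incl N)%FUN); split; last first.
  exact: (torsion_surj fgS torsT gs).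
move=> y'; have [y yE] := fs y'; have [s Ny] := latN y; exists s; apply/im_subP.
by exists (Submod Ny); rewrite /= linearZZ FE yE.
Qed.

(* By the ascending chain condition a single denominator s sends the kernel of
   E0 -> Y3 into the lattice f(N1); then E = s E0 + f(N1) is an extension of N3
   by N1. *)
Lemma loc_class_ext p (Y1 Y2 Y3 : lmodType (Lp p))
    (f : {linear Y1 -> Y2}) (g : {linear Y2 -> Y3}) :
  short_exact f g -> loc_class T Y1 -> loc_class T Y3 -> loc_class T Y2.
Proof.
move=> [_ gs ex] /loc_class_lattice[N1 [lat1 T1]] /loc_class_lattice[N3 [lat3 T3]].
have [F FE] := linear_res f; have [G GE] := linear_res g.
have [|E0 [fgE0 E0P]] := fg_lift (g := G) (tors_fg T3).
  by move=> v _; have [u uv] := gs v; exists u; rewrite GE.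
have hN : is_submod (fun y => exists2 n, n \in N1 & y = F n).
  exact: is_submod_im (is_submod_mem N1).
have hK (s : denom p) : is_submod (fun e : submod E0 =>
    exists2 n, n \in N1 & smul (res p Y2) (den s) (incl E0 e) = F n).
  exact: (is_submod_pre (incl E0) (is_submod_pre (smul (res p Y2) (den s)) hN)).
have [|K [[s ->] max]] := ACC_fg noethL fgE0 (P := fun K => exists s, K = submod_of (hK s)).
  by exists (submod_of (hK den1)), den1.
have sE0 e : e \in E0 -> G e = 0 -> exists2 n, n \in N1 & den s ** e = F n.
  move=> E0e Ge; have [y1 fy1] : exists y1, f y1 = e by apply/ex; rewrite -GE.
  have [t N1y] := lat1 y1.
  suff /submod_ofP : Submod E0e \in submod_of (hK s) by [].
  (* The submodule for s is contained in the one for s t, so by maximality they coincide. *)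
  apply: (max (submod_of (hK (denM s t)))); first by exists (denM s t).
    move=> x /submod_ofP[n N1n nE]; apply/submod_ofP; exists (den t ** n).
      exact: rpredZ.
    by rewrite smulE /= mulrC rmorphM -scalerA linearZZ -nE.
  apply/submod_ofP; exists (den s ** (den t ** (y1 : res p Y1))); first exact: rpredZ.
  by rewrite smulE /= !linearZZ FE [X in _ *: (_ *: X)](fy1 : _ = _) rmorphM -scalerA.
have hE := is_submod_add (is_submod_im (smul (res p Y2) (den s)) (is_submod_mem E0)) hN.
pose E := submod_of hE.
have EP y : y \in E <-> exists e n, [/\ e \in E0, n \in N1 & y = den s ** e + F n].
  split=> [/submod_ofP[_ [_ [[e E0e ->] [n N1n ->] ->]]]|[e [n [E0e N1n ->]]]].
    by exists e, n.
  apply/submod_ofP; exists (den s ** e), (F n); split=> //; last by exists n.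
  by exists e.
have GF n : G (F n) = 0 by rewrite GE FE; apply/ex; exists n.
(* G carries E onto s N3, since it kills F(N1); h is G divided by s, hence a map from E onto N3. *)
have [||h hhE] := lift_through (f := (smul (res p Y3) (den s) \o incl N3)%FUN)
    (g := (G \o incl E)%FUN).
- by apply: linear_inj0 => v /res_den_inj e; apply: incl_inj; rewrite e linear0.
- move=> x; have /EP[e [n [E0e N1n xE]]] := submod_valP x.
  have N3e : G e \in N3 by apply/E0P; exists e.
  by exists (Submod N3e); rewrite /= xE linearD GF addr0 linearZZ.
have hG x : den s ** incl N3 (h x) = G (incl E x) by apply: hhE.
have hs : surjective h.
  move=> v; have /E0P[e E0e ve] := submod_valP v.
  have Ee : den s ** e \in E.
    by apply/EP; exists e, 0; rewrite rpred0 linear0 addr0.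
  exists (Submod Ee); apply: incl_inj; apply/eqP; rewrite -subr_eq0; apply/eqP.
  apply: (res_den_inj (s := s)); rewrite scalerBr hG /= linearZZ.
  by rewrite ve subrr.
have F1E n : F (incl N1 n) \in E.
  apply/EP; exists 0, (incl N1 n); rewrite rpred0 scaler0 add0r; split=> //.
  exact: submod_valP.
have [F1 F1P] := corestrict (f := (F \o incl N1)%FUN) F1E.
have hF1 n : h (F1 n) = 0.
  by apply: incl_inj; apply: (res_den_inj (s := s)); rewrite hG F1P /= GF.
have kh x : h x = 0 -> exists n, F1 n = x.
  move=> hx; have /EP[e [n [E0e N1n xE]]] := submod_valP x.
  have Ge : G e = 0.
    apply: (res_den_inj (s := s)); have := hG x.
    by rewrite hx linear0 scaler0 /= xE linearD GF addr0 linearZZ.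
  have [n' N1n' n'E] := sE0 e E0e Ge.
  exists (Submod N1n' + Submod N1n); apply: incl_inj; rewrite F1P /= xE n'E.
  by rewrite linearD.
apply/loc_class_lattice; exists E; split; last first.
  apply: (torsion_ext fgS torsT (f := F1) (g := h) T1) => //.
  by apply: (fg_ext (f := F1) (g := h)) => //; apply: tors_fg.
(* E is a lattice: t y agrees with some e of E0 up to an element f(u), t' moves u into N1, and
   multiplying everything by s t' lands in E. *)
move=> y; have [t /E0P[e E0e Gy]] := lat3 (g y).
have [u uE] : exists u, f u = (den t ** (y : res p Y2) - e : res p Y2).
  by apply/ex; rewrite -GE linearB linearZZ -Gy GE subrr.
have [t' N1u] := lat1 u.
exists (denM (denM s t') t); apply/EP.
exists (den t' ** e), (den s ** (den t' ** (u : res p Y1))); split; try exact: rpredZ.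
rewrite !linearZZ FE [X in _ + _ *: (_ *: X)](uE : _ = _) !scalerBr !alg_scaleM /=.
by rewrite addrC subrK.
Qed.

Lemma Phi_in_T : in_T (@Phi_t R L T).
Proof.
move=> p; split=> [Y [] //|Y flY Y0|X Y f [lcX flX] flY fs|X Y Z f g [lcX _] flY [lcZ _] ex].
- split=> //; apply/loc_class_lattice; exists (submod_of (is_submod0P (res p Y))); split.
    by move=> y; exists den1; apply/submod_ofP; apply: Y0.
  case: torsT => _ T0 _ _; apply: T0 => [|x].
    by exists 0%N, (fun=> 0) => x; exists (fun=> 0); rewrite big_ord0; apply: incl_inj; apply: Y0.
  by apply: incl_inj; apply: Y0.
- by split=> //; apply: loc_class_surj lcX; first exact: fs.
- by split=> //; apply: loc_class_ext ex lcX lcZ.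
Qed.

(* The modules X_q and (X_p)_q agree. *)
Lemma Phi_compatible (p q : prime_idealr R) : {subset q <= p} ->
  class_sub (@Phi_t R L T q) (@restr R L p q (@Phi_t R L T p)).
Proof.
move=> sqp Y [[X [TX isoY]] flY]; split=> //.
have npq (s : denom p) : exists t : denom q, den t = den s.
  by apply: not_mem_denom; apply/negP => /sqp; apply/negP/denP.
exists (res p (loc p X)); split.
  exists (loc p X); split; last exact: isomorphic_refl.
  have fgX := tors_fg TX; split; first exact: fg_loc.
  split; last exact: (@reduction_finite_length R L p noethL.2 X fgX).
  exists (mod_ideal p X); split; last exact: reduction_iso.
  exact: (torsion_surj fgS torsT (@mod_ideal_surj _ _ p X)).
have /isomorphic_locP[f [fg kf]] := isoY.
have kg x : f x = 0 <-> frac1 q _ (frac1 p X x) = 0.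
  rewrite kf frac1_eq0; split=> [[s sx]|[s]].
    by exists s; rewrite -linearZZ sx linear0.
  rewrite -linearZZ => /frac1_eq0[t tE]; have [t' t'E] := npq t.
  by exists (denM t' s); rewrite /= t'E rmorphM -scalerA.
apply: (loc_iso (f := f) (g := (frac1 q _ \o frac1 p X)%FUN) fg) => [x|v]; first exact: kg.
have [s [w sw]] := frac1_generic v; have [t [x tx]] := frac1_generic w.
have [t' t'E] := npq t; exists (denM t' s), x.
by rewrite rmorphM -scalerA sw t'E -linearZZ tx.
Qed.

End TorsionClass.

Lemma Phi_le T T' : class_sub T T' -> family_le (@Phi_t R L T) (@Phi_t R L T').
Proof. by move=> TT' p Y [[X [TX iso]] flY]; split=> //; exists X; split=> //; apply: TT'. Qed.

Lemma ex_prime (P : R -> Prop) : P 0 -> ~ P 1 -> (forall x y, P x -> P y -> P (x + y)) ->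
  (forall a x, P x -> P (a * x)) -> (forall x y, P (x * y) -> P x \/ P y) ->
  exists p : prime_idealr R, forall x, x \in p <-> P x.
Proof.
move=> P0 P1 PD PM Pprime; pose S : R -> bool := fun x => `[< P x >].
have SE x : (x \in (S : {pred R})) = `[< P x >] by [].
have S_ideal : idealr_closed (S : {pred R}).
  split; rewrite ?SE; [exact/asboolP|exact/asboolP|].
  by move=> a x y /asboolP Px /asboolP Py; apply/asboolP/PD => //; apply: PM.
have S_prime : prime_idealr_closed (S : {pred R}).
  by move=> x y /asboolP/Pprime[]/asboolP h; apply/orP; [left|right].
pose Z := GRing.isZmodClosed.Build R S (idealr_closedB S_ideal).
pose I := isProperIdeal.Build R S (idealr_closed_nontrivial S_ideal).
pose Q := isPrimeIdealrClosed.Build R S S_prime.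
pose p : prime_idealr R := HB.pack S Z I Q.
by exists p => x; split=> [/asboolP|h]; last exact/asboolP.
Qed.

(* A minimal counterexample Z in T is killed or acted on injectively by every
   element of R; so its annihilator p is prime, and Z_p has finite length. *)
Lemma Phi_reflect T T' : tors T -> tors T' ->
  family_le (@Phi_t R L T) (@Phi_t R L T') -> class_sub T T'.
Proof.
move=> torsT torsT' le X TX; apply: contrapT => nTX.
have fgS (U V : lmodType L) (f : {linear U -> V}) : surjective f -> mod_fg U -> mod_fg V.
  exact: fg_surj.
have fgX := tors_fg torsT TX.
have [Z [f [fs fgZ nTZ T'0 endZ]]] :=
  torsion_minimal fgS torsT' (ACC_fg noethL fgX) fgX nTX.
have TZ : T Z := torsion_surj fgS torsT fs TX.
have [z0 nz0] : exists z : Z, z <> 0.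
  apply: contrapT => Z0; apply: nTZ; case: torsT' => _ T0 _ _; apply: T0 => // x.
  by apply: contrapT => x0; apply: Z0; exists x.
have dich r : (forall z : Z, r ** z = 0) \/ (forall z : Z, r ** z = 0 -> z = 0).
  have [|inj] := endZ (smul Z r); first by left.
  by right=> z rz; apply: inj; rewrite linear0.
have [|||||p pP] := @ex_prime (fun r => forall z : Z, r ** z = 0).
- by move=> z; rewrite rmorph0 scale0r.
- by move=> /(_ z0); rewrite rmorph1 scale1r.
- by move=> r s r0 s0 z; rewrite rmorphD scalerDl r0 s0 addr0.
- by move=> r s s0 z; rewrite rmorphM -scalerA s0 scaler0.
- move=> r s rs0; have [r0|ri] := dich r; [by left|right=> z].
  by apply: ri; rewrite alg_scaleM.
have Zi (s : denom p) (z : Z) : den s ** z = 0 -> z = 0.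
  have [s0|si] := dich (den s); last exact: si.
  by have := denP s; rewrite (pP _).2.
have flZ : finite_length (loc p Z).
  apply: (killed_finite_length noethL.2); first exact: fg_loc.
  move=> r v /pP rZ; have [s [z sz]] := frac1_generic v.
  by apply: (res_den_inj (s := s)); rewrite alg_scaleC sz -linearZZ rZ linear0.
have [[W [T'W isoW]] _] : Phi_t T' (loc p Z).
  by apply: le; split=> //; exists Z; split=> //; apply: isomorphic_refl.
have /isomorphic_locP[g [gg _]] := isoW.
(* W is finitely generated, so one t clears the denominators of all values of g; as Z embeds in Z_p,
   t g lifts to a map from W to Z. *)
have [t tP] : exists t : denom p, forall w, exists z, den t ** g w = frac1 p Z z.
  have /fg_seqP[l lP] := tors_fg torsT' T'W.
  suff [t tP] : exists t : denom p, forall w, w \in l -> exists z, den t ** g w = frac1 p Z z.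
    exists t; apply: lP => //; split; first by exists 0; rewrite !linear0 scaler0.
    - by move=> x y [z zE] [z' z'E]; exists (z + z'); rewrite !linearD scalerDr zE z'E.
    - by move=> a x [z zE]; exists (a *: z); rewrite !linearZZ alg_scaleC zE.
  elim: l {lP} => [|w l [t tl]]; first by exists den1.
  have [s [z sz]] := frac1_generic (g w); exists (denM s t) => w'.
  rewrite inE => /predU1P[->|/tl[z' z'E]].
    by exists (den t ** z); rewrite linearZZ -sz alg_scaleM mulrC.
  by exists (den s ** z'); rewrite rmorphM -scalerA z'E linearZZ.
have inj1 : injective (frac1 p Z) by apply: linear_inj0 => z /frac1_eq0[s /Zi].
have [h hE] := lift_through (g := (smul _ (den t) \o g)%FUN) inj1 tP.
(* Some s z0 is a value of g, and t g vanishes because [T'0] makes h zero; both s and t act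
   injectively on Z_p. *)
apply: nz0; apply: inj1; rewrite linear0; have [s [w sw]] := gg (frac1 p Z z0).
apply: (res_den_inj (s := s)); rewrite sw; apply: (res_den_inj (s := t)).
by apply: etrans (esym (hE w)) _; rewrite (T'0 _ h T'W) linear0.
Qed.

End PhiT.

(** * Gluing *)

Section Primes.
Variable R : comNzRingType.

(** Families are indexed by prime structures, so primes with the same elements must be identified
    before their components can be. *)
Lemma prime_ext (p q : prime_idealr R) : p =i q -> p = q.
Proof.
case: p q => [S [[a] [b] [c] [d]]] [S' [[a'] [b'] [c'] [d']]] e.
have eS : S = S' by apply: funext => x; apply: e.
subst S'; rewrite (Prop_irrelevance a' a) (Prop_irrelevance b' b).
by rewrite (Prop_irrelevance c' c) (Prop_irrelevance d' d).
Qed.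

(** An ideal K maximal among those containing I and missing S is prime: for x, y outside K, S meets
    K + Rx and K + Ry, and if xy were in K the product of the two elements would lie in both S and
    K. *)
Lemma prime_avoiding (I : submodClosed R^o) (S : R -> Prop) : noetherian_ring R ->
  S 1 -> (forall x y, S x -> S y -> S (x * y)) -> (forall x, x \in I -> ~ S x) ->
  exists p : prime_idealr R, (forall x, x \in I -> x \in p) /\ forall x, x \in p -> ~ S x.
Proof.
move=> noeR S1 SM IS.
have [|K [[sIK KS] max]] := noetherian_ACC noeR
    (P := fun K => {subset I <= K} /\ forall x, x \in K -> ~ S x).
  by exists I; split.
have big x : x \notin K -> exists k a, k \in K /\ S (k + a * x).
  move=> nKx; apply: contrapT => nS; move/negP: nKx; apply.
  have [K' K'P] := ex_submod (is_submod_add (is_submod_mem K) (is_submod_line (x : R^o))).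
  have sK : {subset K <= K'}.
    move=> y Ky; apply/K'P; exists y, 0; rewrite addr0; split=> //.
    by exists 0; rewrite scale0r.
  apply: (max K') => //; last first.
    by apply/K'P; exists 0, x; rewrite add0r rpred0; split=> //; exists 1; rewrite scale1r.
  split=> [y /sIK/sK //|_ /K'P[k [_ [Kk [a ->] ->]]] Sy].
  by apply: nS; exists k, a.
have [|||||p pP] := @ex_prime R (fun x => x \in K).
- exact: rpred0.
- by move=> /KS; apply.
- by move=> x y Kx Ky; apply: rpredD.
- by move=> a x Kx; apply: (@rpredZ _ R^o).
- move=> x y Kxy; have [Kx|/big[k [a [Kk Sx]]]] := boolP (x \in K); first by left.
  have [Ky|/big[k' [a' [Kk' Sy]]]] := boolP (y \in K); first by right.
  case: (KS _ _ (SM _ _ Sx Sy)).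
  have -> : (k + a * x) * (k' + a' * y) = (k' + a' * y) * k + (a * x) * k' + (a * a') * (x * y).
    by ring.
  by rewrite !rpredD //; apply: (@rpredZ _ R^o).
by exists p; split=> x; rewrite pP //; [apply: sIK|apply: KS].
Qed.

Hypothesis dim1 : krull_dim R 1.

Lemma no_chain (a b c : prime_idealr R) : {subset a <= b} -> ~ {subset b <= a} ->
  {subset b <= c} -> {subset c <= b}.
Proof.
move=> ab nba bc; apply: contrapT => ncb.
have [_ max] := dim1; suff: (2 <= 1)%N by []; apply: max.
exists (fun i : 'I_3 => nth a [:: a; b; c] i) => -[[|[|[|i]]] hi] [[|[|[|j]]] hj] //= _.
  split; first by move=> x ax; apply: bc; apply: ab.
  by move=> ca; apply: nba => x bx; apply: ca; apply: bc.
Qed.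

Hypothesis noeR : noetherian_ring R.
Hypothesis locR : semi_local R.

Lemma finite_primes_above (q : prime_idealr R) :
  exists (I : finType) (P : I -> prime_idealr R),
    (forall i, {subset q <= P i}) /\
    forall p : prime_idealr R, {subset q <= p} -> exists i, p = P i.
Proof.
have [n [m mP]] := locR.
(* Some m i may be no prime above q; q itself then serves as the default value. *)
have /choice[P PP] : forall i : 'I_n, exists p : prime_idealr R, {subset q <= p} /\
    forall p' : prime_idealr R, {subset q <= p'} -> p' =i m i -> p' = p.
  move=> i; have [[p [qp pm]]|np] := pselect (exists p : prime_idealr R,
    {subset q <= p} /\ p =i m i).
    by exists p; split=> // p' _ p'm; apply: prime_ext => x; rewrite pm p'm.
  by exists q; split=> // p' qp' p'm; case: np; exists p'.
(* [None] stands for q, which need not be maximal. *)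
exists (option 'I_n), (fun i => if i is Some j then P j else q).
split=> [[i|] //|p qp]; first exact: (PP i).1.
have [pq|npq] := pselect {subset p <= q}.
  by exists None; apply: prime_ext => x; apply/idP/idP => [/pq|/qp].
(* An ideal I above p is proper, so it lies in a prime p' (avoid the set {1}); q strictly below p
   leaves no room for p' strictly above p. *)
have maxp : maximal_ideal p.
  move=> I pI; have hI : is_submod (fun x : R^o => x \in I).
    split=> [|x y Ix Iy|a x Ix]; [exact: idealr0|exact: rpredD|exact: idealMr].
  have [J JP] := ex_submod hI.
  have [|||p' [Jp' _]] := @prime_avoiding J (fun x => x = 1) noeR.
  - by [].
  - by move=> x y -> ->; rewrite mulr1.
  - by move=> x /JP Ix x1; rewrite x1 idealr1 in Ix.
  move=> x Ix; apply: (no_chain qp npq (c := p')); last by apply/Jp'/JP.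
  by move=> y /pI Iy; apply/Jp'/JP.
by have [i pi] := mP _ maxp; exists (Some i); apply: (PP i).2.
Qed.

End Primes.

(** * Lattices with prescribed localizations *)

Section Gluing.
Variables (R : comNzRingType) (L : algebra R).
Hypothesis noethL : noetherian_algebra L.
Hypothesis dim1 : krull_dim R 1.
Hypothesis locR : semi_local R.
Local Notation "r ** x" := (alg_map _ r *: x) (at level 40).
Local Notation Lp p := (loc_alg L p).
Local Notation res p := (restrict (loc_alg_map L p)).

(** The elements that fall into P after localization at p. Mutual containment in saturations
    expresses that two submodules agree locally at p. *)
Definition saturation p (W : lmodType L) (P : W -> Prop) (x : W) : Prop :=
  exists s : denom p, P (den s ** x).

Lemma is_submod_saturation p (W : lmodType L) (P : W -> Prop) :
  is_submod P -> is_submod (saturation p P).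
Proof.
move=> hP; split; first by exists den1; rewrite scaler0; apply: is_submod0.
- move=> x y [s Px] [t Py]; exists (denM s t); rewrite scalerDr.
  apply: is_submodD => //; rewrite rmorphM -scalerA; last exact: is_submodZ.
  by rewrite alg_scaleC; apply: is_submodZ.
- by move=> a x [s Px]; exists s; rewrite alg_scaleC; apply: is_submodZ.
Qed.

Lemma saturation_sub p (W : lmodType L) (P : W -> Prop) x : P x -> saturation p P x.
Proof. by move=> Px; exists den1; rewrite rmorph1 scale1r. Qed.

Lemma saturation_den p (W : lmodType L) (P : W -> Prop) (s : denom p) x :
  saturation p P (den s ** x) -> saturation p P x.
Proof. by move=> [t Px]; exists (denM t s); rewrite rmorphM -scalerA. Qed.

Lemma common_den p (W : lmodType L) (P : W -> Prop) (l : seq W) : is_submod P ->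
  (forall x, x \in l -> saturation p P x) ->
  exists s : denom p, forall x, x \in l -> P (den s ** x).
Proof.
move=> hP; elim: l => [_|x l IH Pl]; first by exists den1.
have [|s sP] := IH; first by move=> y yl; apply: Pl; rewrite inE yl orbT.
have [t tx] := Pl x (mem_head x l); exists (denM s t) => y.
rewrite inE rmorphM -scalerA => /predU1P[->|/sP Py]; first exact: is_submodZ.
by rewrite alg_scaleC; apply: is_submodZ.
Qed.

(* Otherwise the ideal of the a that map l1 to the p2-saturation of span l2 lies
   in a prime contained in p1 and in p2 and strictly containing q. *)
Lemma separate (q p1 p2 : prime_idealr R) (W : lmodType L) (l1 l2 : seq W) :
  {subset q <= p1} -> {subset q <= p2} -> p1 <> p2 ->
  (forall x : W, saturation q (span l2) x) ->
  (forall r, r \in q -> exists k, forall x : W, r ^+ k ** x = 0) ->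
  exists s : denom p1, forall x, x \in l1 -> saturation p2 (span l2) (den s ** x).
Proof.
move=> qp1 qp2 np12 lat2 nilW; have [noeR _] := noethL.
have hS := is_submod_saturation p2 (is_submod_span l2).
have hI : is_submod (fun a : R^o => forall x, x \in l1 -> saturation p2 (span l2) (a ** x)).
  split.
  - by move=> x _; rewrite (rmorph0 (alg_map L)) scale0r; apply: is_submod0.
  - move=> a b Ia Ib x xl; rewrite (rmorphD (alg_map L)) scalerDl.
    by apply: is_submodD => //; [apply: Ia|apply: Ib].
  - move=> a b Ib x xl; rewrite (rmorphM (alg_map L)) -scalerA.
    by apply: is_submodZ => //; apply: Ib.
have [I IP] := ex_submod hI.
(* The multiplicative set generated by both complements: a prime missing it lies in p1 and in p2. *)
pose S (x : R) := exists (s : denom p1) (t : denom p2), x = den s * den t.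
have [[x [Ix [s [t xE]]]]|nIS] := pselect (exists x, x \in I /\ S x).
  exists s => y yl; have /IP/(_ y yl) := Ix.
  by rewrite xE mulrC rmorphM -scalerA; apply: saturation_den.
exfalso; have [|||p [Ip pS]] := prime_avoiding (I := I) (S := S) noeR.
- by exists den1, den1; rewrite mulr1.
- move=> _ _ [s [t ->]] [s' [t' ->]]; exists (denM s s'), (denM t t').
  by rewrite /= mulrACA.
- by move=> x Ix Sx; apply: nIS; exists x.
have pp1 : {subset p <= p1}.
  move=> x px; apply: contraT => /not_mem_denom[s sx].
  by case: (pS x px); exists s, den1; rewrite mulr1.
have pp2 : {subset p <= p2}.
  move=> x px; apply: contraT => /not_mem_denom[s sx].
  by case: (pS x px); exists den1, s; rewrite mul1r.
have qp : {subset q <= p}.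
  move=> r /nilW[k rk]; have : r ^+ k \in p.
    by apply: Ip; apply/IP => x _; rewrite rk; apply: is_submod0.
  elim: k {rk} => [|k IH]; first by rewrite expr0 idealr1.
  by rewrite exprS prime_idealrM => /orP[].
(* The span of l2 is everything locally at q, so a common denominator outside q carries l1 into it
   and thus belongs to I. *)
have npq : ~ {subset p <= q}.
  move=> pq; have [c cP] := common_den (l := l1) (is_submod_span l2) (fun x _ => lat2 x).
  have /negP := denP c; apply; apply: pq; apply: Ip; apply/IP => x xl.
  by apply: saturation_sub; apply: cP.
(* With q strictly below p, dimension one forces p1 = p = p2. *)
apply: np12; apply: prime_ext => x; apply/idP/idP => h.
  by apply: pp2; apply: (no_chain dim1 qp npq pp1).
by apply: pp1; apply: (no_chain dim1 qp npq pp2).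
Qed.

Lemma glue (q : prime_idealr R) (W : lmodType L) (I : finType) (P : I -> prime_idealr R)
    (l : prime_idealr R -> seq W) :
  (forall i, {subset q <= P i}) ->
  (forall i (x : W), saturation q (span (l (P i))) x) ->
  (forall r, r \in q -> exists k, forall x : W, r ^+ k ** x = 0) ->
  exists t : seq W, forall i,
    (forall x, span t x -> saturation (P i) (span (l (P i))) x) /\
    (forall x, span (l (P i)) x -> saturation (P i) (span t) x).
Proof.
move=> qP lat nilW.
(* The enumeration P may repeat a prime; there a = 1 works, which includes the case i = j. *)
have /choice[a aP] : forall ij, exists a, a \notin P ij.1 /\
    forall x, x \in l (P ij.1) -> saturation (P ij.2) (span (l (P ij.2))) (a ** x).
  move=> [i j] /=; have [<-|nij] := pselect (P i = P j).
    exists 1; split=> [|x xl]; first by rewrite idealr1.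
    by rewrite rmorph1 scale1r; apply: saturation_sub; apply: span_mem.
  have [s sP] := @separate q (P i) (P j) W (l (P i)) (l (P j)) (qP i) (qP j) nij (lat j) nilW.
  by exists (den s); split; first exact: denP.
(* [b i] is outside [P i] and carries [l (P i)] into the saturation at every [P j]. So at [P j] no
   summand exceeds the span of [l (P j)], and the j-th one fills it because [b j] is invertible
   there. *)
pose b i := \prod_j a (i, j).
have bP i : exists s : denom (P i), den s = b i.
  apply: not_mem_denom; rewrite /b; elim/big_rec: _ => [|j x _ px]; first by rewrite idealr1.
  by rewrite prime_idealrM negb_or (aP (i, j)).1.
exists [seq b i ** x | i <- enum I, x <- l (P i)] => j; split=> x.
  move=> tx; apply: (tx (saturation (P j) (span (l (P j))))).
    exact: is_submod_saturation (is_submod_span _).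
  move=> _ /allpairsPdep[i [y [_ yl ->]]].
  rewrite /b (bigD1 j) //= mulrC -alg_scaleM.
  apply: is_submodZ; first exact: is_submod_saturation (is_submod_span _).
  exact: (aP (i, j)).2.
move=> lx; have [s sE] := bP j; exists s; rewrite sE.
apply: (lx (fun x => span _ (b j ** x))).
  exact: (is_submod_pre (smul W (b j)) (is_submod_span _)).
move=> y yl; apply: span_mem; apply/allpairsPdep; exists j, y.
by rewrite mem_enum.
Qed.

(** * The torsion class of a compatible family *)

Section Family.
Variable X : family L.

Definition from_family : modclass L :=
  fun M => finitely_generated M /\ forall p, X (reduction p M).

Lemma reduction0 p (M : lmodType L) : (forall x : M, exists s : denom p, den s ** x = 0) ->
  forall v : reduction p M, v = 0.
Proof.
move=> M0 v; have [f [fg kf]] := reductionP p M; have [s [x sx]] := fg v.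
apply: (res_den_inj (s := s)); rewrite sx; apply/kf; have [t tx] := M0 x.
by exists t; rewrite tx; apply: (is_submod0 (is_submod_ideal p M)).
Qed.

Lemma isomorphic_surj (A : pzRingType) (U V : lmodType A) : isomorphic U V ->
  exists g : {linear V -> U}, surjective g.
Proof.
move=> [f [k fk kf]]; have [||g gE] := @linear_of _ _ _ k.
- by move=> x y; apply: (can_inj fk); rewrite linearD !kf.
- by move=> a x; apply: (can_inj fk); rewrite linearZ !kf.
by exists g => u; exists (f u); rewrite gE fk.
Qed.

Hypothesis inT : in_T X.

Lemma family0 p (Y : lmodType (Lp p)) : (forall y : Y, y = 0) -> X Y.
Proof. by move=> Y0; case: (inT p) => _ C0 _ _; apply: C0 => //; apply: finite_length0. Qed.

Lemma from_family_tors : tors from_family.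
Proof.
split=> [Y [] //|Y fgY Y0|Y Z f [fgY XY] fgZ fs|U Y Z f g [fgU XU] fgY [fgZ XZ] ex].
- split=> // p; apply: family0; apply: reduction0 => y; exists den1.
  by rewrite (Y0 y) scaler0.
- split=> // p; have [g gs] := reduction_surj p fs.
  exact: (torsion_surj (@finite_length_closed _ L p) (inT p) gs).
- by split=> // p; apply: (reduction_ext noethL.2 (inT p) fgY ex).
Qed.

(** Y/pY is a factor of the reduction of M, hence in X^p, and [torsion_mod_ideal] passes from Y/pY
    to Y. *)
Lemma Phi_from_family_le : family_le (@Phi_t R L from_family) X.
Proof.
move=> p Y [[M [[_ XM] isoY]] flY]; have [g gs] := isomorphic_surj isoY.
have [h hs] := mod_ideal_map_surj p gs.
apply: (torsion_mod_ideal noethL.2 (inT p) flY).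
exact: (torsion_surj (@finite_length_closed _ L p) (inT p) hs (XM p)).
Qed.

Hypothesis compX : forall p q : prime_idealr R, {subset q <= p} ->
  class_sub (@X q) (@restr R L p q (@X p)).

(** Compatibility presents Y as V_q with V/pV in X^p, and l is the image of generators of V. If M
    agrees with the span of l locally at p, then M_p is a factor of V, so its reduction is a factor
    of V/pV. *)
Lemma compatible_lattice (p q : prime_idealr R) (Y : lmodType (Lp q)) :
  {subset q <= p} -> X Y -> exists l : seq (res q Y),
    (forall y, saturation q (span l) y) /\
    forall M : submodClosed (res q Y),
      (forall y, y \in M -> saturation p (span l) y) ->
      (forall y, span l y -> saturation p (fun z => z \in M) y) ->
      X (reduction p (submod M)).
Proof.
move=> sqp XY; have npq (s : denom p) : exists t : denom q, den t = den s.
  by apply: not_mem_denom; apply/negP => /sqp; apply/negP/denP.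
have [[Z [[V [[fgV XV] isoZ]] isoY]] _] := compX sqp XY.
have [j js] := isomorphic_surj isoZ; have /isomorphic_locP[b [gb _]] := isoY.
pose a : {linear res p V -> res q Y} := (b \o j)%FUN.
have /fg_seqP[s sP] := fgV; exists [seq a v | v <- s].
set l := [seq _ | _ <- _].
(* The list s generates V over L_p, not over L; hence the saturation. *)
have al v : saturation p (span l) (a v).
  apply: (sP (fun v : res p V => saturation p (span l) (a v))) => [|w ws].
    apply: (@is_submod_loc R L p V); first exact: (is_submod_pre a (is_submod_saturation p (is_submod_span l))).
    by move=> t w; rewrite linearZZ; apply: saturation_den.
  by apply: saturation_sub; apply: span_mem; apply: map_f.
have la y : span l y -> exists v, y = a v.
  move=> ly; have [v _ ->] : exists2 v, True & y = a v; last by exists v.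
  apply: (ly (fun y => exists2 v, True & y = a v)).
    exact: is_submod_im (is_submodT _).
  by move=> _ /mapP[v _ ->]; exists v.
split=> [y|M Ml lM].
  have [t [z tz]] := gb y; have [v vz] := js z; have [t' t'E] := al v.
  have [u uE] := npq t'; exists (denM u t).
  by rewrite rmorphM -scalerA tz uE -vz.
(* N is the part of V that a maps into M. By [lM] it still spans V over R_p, so the map from N
   through M to M_p extends to V. *)
have [N NP] := ex_submod (is_submod_pre a (is_submod_mem M)).
have Na (v : submod N) : a (incl N v) \in M by apply/NP; apply: submod_valP.
have [c cE] := corestrict (f := (a \o incl N)%FUN) Na.
have gN : generic (incl N).
  move=> v; have [t /lM[t' t'E]] := al v; exists (denM t' t).
  have Nv : den (denM t' t) ** v \in N by apply/NP; rewrite linearZZ rmorphM -scalerA.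
  by exists (Submod Nv).
have [x|h hE] := loc_lift (g := (frac1 p (submod M) \o c)%FUN) gN.
  move=> /= x0; rewrite (_ : x = 0) ?linear0 //; apply: incl_inj.
  by rewrite linear0.
have hs : surjective h.
  apply: (loc_lift_surj (f := incl N) hE) => w.
  have [t [m tm]] := frac1_generic w.
  have [t' /la[v vE]] := Ml _ (submod_valP m).
  have Nv : v \in N by apply/NP; rewrite -vE; apply: rpredZ; apply: submod_valP.
  exists (denM t' t), (Submod Nv).
  rewrite rmorphM -scalerA tm -linearZZ; congr (frac1 p (submod M) _).
  by apply: incl_inj; rewrite cE linearZZ; apply: vE.
have [k ks] := mod_ideal_map_surj p hs.
exact: (torsion_surj (@finite_length_closed _ L p) (inT p) ks).
Qed.

Lemma le_Phi_from_family : family_le X (@Phi_t R L from_family).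
Proof.
move=> q Y XY; have flY : finite_length Y by case: (inT q) => XD _ _ _; apply: XD.
split=> //.
have /choice[l lP] : forall p : prime_idealr R, exists l : seq (res q Y), {subset q <= p} ->
    (forall y, saturation q (span l) y) /\
    forall M : submodClosed (res q Y),
      (forall y, y \in M -> saturation p (span l) y) ->
      (forall y, span l y -> saturation p (fun z => z \in M) y) ->
      X (reduction p (submod M)).
  move=> p; have [sqp|nsqp] := pselect {subset q <= p}; last by exists [::].
  by have [l lP] := compatible_lattice sqp XY; exists l.
have nil := finite_length_nilpotent noethL.2 flY.
have [I [P [qP allP]]] := finite_primes_above dim1 noethL.1 locR q.
have [t tP] := glue qP (fun i => (lP _ (qP i)).1) nil.
pose N := submod_of (is_submod_span t).
have NP y : y \in N <-> span t y by apply: submod_ofP.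
(* q itself occurs among the [P i], and at that index N agrees locally with a list that spans Y over
   R_q. *)
have latN : lattice N.
  move=> y; have [i qi] := allP q (fun x qx => qx).
  have [s /(tP i).2[u tu]] := (lP _ (qP i)).1 y; have [u' u'E] : exists u' : denom q, den u' = den u.
    by apply: not_mem_denom; rewrite qi; apply: denP.
  by exists (denM u' s); rewrite rmorphM -scalerA u'E; apply/NP.
exists (submod N); split; last exact: lattice_iso.
split=> [|p]; first exact: fg_span.
have [qp|/existsNP[r /not_implyP[qr npr]]] := pselect {subset q <= p}.
  have [i ->] := allP p qp; apply: (lP _ (qP i)).2 => y.
    by move=> /NP/(tP i).1.
  by move=> /(tP i).2[s ts]; exists s; apply/NP.
(* Here p does not contain q: a power of r in q kills Y while staying outside p, so the reduction of
   N at p is zero. *)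
apply: family0; apply: reduction0 => x; have [k rk] := nil r qr.
have [s sE] : exists s : denom p, den s = r ^+ k.
  apply: not_mem_denom; elim: k {rk} => [|k IH]; first by rewrite idealr1.
  by rewrite exprS prime_idealrM negb_or IH andbT; apply/negP.
by exists s; apply: incl_inj; rewrite linearZZ sE linear0; apply: rk.
Qed.
End Family.
End Gluing.

Lemma family_eq_eq (R : comNzRingType) (L : algebra R) (X Y : family L) :
  family_eq X Y -> X = Y.
Proof.
by move=> e; apply: functional_extensionality_dep => p; apply: funext => M; apply/propext/e.
Qed.

Theorem theorem1p5 (R : comNzRingType) (L : algebra R) :
  noetherian_algebra L -> semi_local R -> krull_dim R 1 ->
  compatible_pair L /\
  poset_iso (@tors R L) (@class_sub L)
            (@in_Tc R L) (@family_le R L) (@Phi_t R L).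
Proof.
move=> noethL locR dim1.
have Phi_in_Tc T : tors T -> in_Tc (@Phi_t R L T).
  by move=> torsT; split; [apply: Phi_in_T|apply: Phi_compatible].
have onto (X : family L) : in_Tc X ->
    exists T, [/\ tors T, family_le (@Phi_t R L T) X & family_le X (@Phi_t R L T)].
  move=> [inT compX]; exists (from_family X); split.
  - exact: from_family_tors.
  - exact: Phi_from_family_le.
  - exact: le_Phi_from_family.
split; last first.
  split=> // T T' torsT torsT'; split; first exact: Phi_le.
  exact: Phi_reflect.
move=> X; split=> [[T [torsT /family_eq_eq <-]]|/onto[T [torsT le ge]]]; first exact: Phi_in_Tc.
by exists T; split=> // p Y; split; [apply: le|apply: ge].
Qed.
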